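(* Let $d\ge 1$ and let $W:\mathbb{R}^d\to\mathbb{R}\cup\{+\infty\}$ be a measurable function satisfying all of the following: (1) $W$ is bounded from below by a finite constant $W_{\min}<0$; (2) $W$ is locally integrable, i.e. $\int_B |W|<+\infty$ for every open ball $B\subset\mathbb{R}^d$; (3) $W(x)=W(-x)$ for all $x\in\mathbb{R}^d$; (4) the limit $W_\infty:=\lim_{|x|\to\infty}W(x)$ exists (possibly equal to $+\infty$) and there is $\mu\in\mathcal{P}(\mathbb{R}^d)$ with $E(\mu)<\frac12 W_\infty$; (5) $W$ is lower semi-continuous; (6) there is $R_6>0$ such that, for every $k\in\{1,\dots,d\}$, $W$ is strictly increasing on $\mathbb{R}^{k-1}\times[R_6,\infty)\times\mathbb{R}^{d-k}$ as a function of its $k$-th variable. Then there exists a global minimiser $\rho\in\mathcal{P}(\mathbb{R}^d)$ of the energy $E$. In addition, there exists $K>0$ (depending only on $W$ and the dimension $d$) such that every global minimiser of $E$ on $\mathcal{P}(\mathbb{R}^d)$ has compact support with diameter at most $K$.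
   Context: $\mathcal{P}(\mathbb{R}^d)$ denotes the set of (Borel) probability measures on $\mathbb{R}^d$. The interaction energy $E:\mathcal{P}(\mathbb{R}^d)\to\mathbb{R}\cup\{+\infty\}$ is $$E(\rho)=\frac12\int_{\mathbb{R}^d\times\mathbb{R}^d}W(x-y)\,d\rho(x)\,d\rho(y),$$ which is well defined because $W$ is bounded from below. A global minimiser of $E$ is a $\rho\in\mathcal{P}(\mathbb{R}^d)$ with $E(\rho)\le E(\mu)$ for all $\mu\in\mathcal{P}(\mathbb{R}^d)$. *)

(* Defs.v *)
From HB Require Import structures.
From mathcomp Require Import all_boot all_order all_algebra.
From mathcomp Require Import all_classical all_reals all_analysis.
From mathcomp Require Import measurable_realfun.

Set Implicit Arguments.
Unset Strict Implicit.
Unset Printing Implicit Defensive.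
Import Order.TTheory GRing.Theory Num.Theory.
Import numFieldNormedType.Exports.
Local Open Scope classical_set_scope.
Local Open Scope ring_scope.

(* The sigma-algebra on 'rV[R]_d is the Borel one. *)
HB.instance Definition _ (R : realType) (d : nat) :=
  @isMeasurable.Build (sigma_display (@open 'rV[R]_d)) 'rV[R]_d
    <<s @open 'rV[R]_d >> (@sigma_algebra0 _ setT _)
    (@sigma_algebraC _ (@open 'rV[R]_d)) (@sigma_algebra_bigcup _ setT _).

Section Lebesgue.
Context {R : realType}.

Definition rowcons (d : nat) (p : R * 'rV[R]_d) : 'rV[R]_d.+1 :=
  row_mx p.1%:M p.2.

(* d-dimensional Lebesgue measure, as the iterated product of the
   one-dimensional one; see lebesgueRd_box for its value on boxes. *)
Fixpoint lebesgueRd (d : nat) : set 'rV[R]_d -> \bar R :=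
  match d with
  | 0 => dirac (0 : 'rV[R]_0)
  | d'.+1 => pushforward (lebesgue_measure \x @lebesgueRd d')%E (@rowcons d')
  end.

Lemma open_measurable_rV (d : nat) (A : set 'rV[R]_d) : open A -> measurable A.
Proof. by move=> oA; apply: sub_sigma_algebra. Qed.

Lemma closed_measurable_rV (d : nat) (A : set 'rV[R]_d) :
  closed A -> measurable A.
Proof.
move=> cA; rewrite -(setCK A); apply: measurableC.
by apply: open_measurable_rV; exact: closed_openC.
Qed.

Lemma rowcons_head (d : nat) (x : R) (u : 'rV[R]_d) :
  rowcons (x, u) ord0 ord0 = x.
Proof.
have -> : ord0 = lshift d ord0 :> 'I_(1 + d) by apply: val_inj.
by apply: etrans (row_mxEl _ _ _ _) _; rewrite mxE eqxx mulr1n.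
Qed.

Lemma rowcons_tail (d : nat) (x : R) (u : 'rV[R]_d) (j : 'I_d) :
  rowcons (x, u) ord0 (lift ord0 j) = u ord0 j.
Proof.
have -> : lift ord0 j = rshift 1 j :> 'I_(1 + d) by apply: val_inj.
exact: row_mxEr.
Qed.

Lemma rowcons_ball (d : nat) (x y : R) (u v : 'rV[R]_d) (e : R) :
  ball (rowcons (x, u)) e (rowcons (y, v)) <-> ball x e y /\ ball u e v.
Proof.
split=> [[e0 h]|[hx [e0 hu]]].
  split; first by have := h ord0 ord0; rewrite !rowcons_head.
  split=> // i j; have := h ord0 (lift ord0 j).
  by rewrite !rowcons_tail !ord1.
split=> // i j; rewrite ord1.
case: (unliftP ord0 j) => [k|] ->; last by rewrite !rowcons_head.
by rewrite !rowcons_tail.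
Qed.

Lemma measurable_rowcons (d : nat) : measurable_fun setT (@rowcons d).
Proof.
apply: (measurability (@open 'rV[R]_d.+1)) => // _ [U oU <-]; rewrite setTI.
pose F (i : rat * 'rV[rat]_d * nat) : set (R * 'rV[R]_d) :=
  let q := ratr i.1.1 in let u := map_mx ratr i.1.2 in let e := i.2.+1%:R^-1 in
  if `[< ball (rowcons (q, u)) e `<=` U >] then ball q e `*` ball u e else set0.
suff -> : @rowcons d @^-1` U = \bigcup_i F i.
  apply: countable_bigcupT_measurable => // -[[q u] n]; rewrite /F/=.
  case: asboolP => // _; apply: measurableX; first exact: measurable_ball.
  by apply: open_measurable_rV; apply: ball_open; rewrite invr_gt0.
apply/seteqP; split => [[x v] /= Uxv|[x v] [[[q u] n] _]]; last first.
  rewrite /F/=; case: asboolP => //= qU [qx uv].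
  by apply: qU; apply/rowcons_ball.
have /nbhs_ballP[e /= e0 eU] : nbhs (rowcons (x, v)) U.
  by apply: open_nbhs_nbhs; split.
have [n ne] : exists n : nat, n.+1%:R^-1 < e / 2.
  have e20 : 0 < e / 2 by rewrite divr_gt0.
  have /filter_ex[n hn] := near_infty_natSinv_lt (PosNum e20).
  by exists n.
have rq (y : R) : exists q : rat, ball (ratr q : R) n.+1%:R^-1 y.
  have /rat_in_itvoo[q] : y < y + n.+1%:R^-1 by rewrite ltrDl invr_gt0.
  rewrite in_itv/= => /andP[yq qy]; exists q.
  by rewrite /ball/= ger0_norm ?subr_ge0 ?(ltW yq)// ltrBlDl.
have [q xq] := rq x.
have [f vf] := choice (fun j => rq (v ord0 j)).
have vu : ball (map_mx ratr (\row_j f j) : 'rV[R]_d) n.+1%:R^-1 v.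
  by split; [rewrite invr_gt0|move=> i j; rewrite !mxE ord1; exact: vf].
exists (q, \row_j f j, n) => //; rewrite /F/= asboolT//.
apply: (subset_trans _ eU) => w hw.
rewrite [e]splitr; apply: ball_triangle (le_ball (ltW ne) hw).
by apply: (le_ball (ltW ne)); apply: ball_sym; apply/rowcons_ball.
Qed.

Lemma sigma_finite_balls d (m : {measure set 'rV[R]_d -> \bar R}) :
  (forall n : nat, (m (ball 0%R n.+1%:R) < +oo)%E) ->
  exists m' : {sigma_finite_measure set 'rV[R]_d -> \bar R}, m' = m :> (set _ -> _).
Proof.
move=> mf; have s : sigma_finite setT m.
  exists (fun n => ball 0%R n.+1%:R).
    apply/seteqP; split => // x _; exists (Num.truncn `|x|) => //.
    by rewrite mx_norm_ball /ball_/= sub0r normrN; exact: truncnS_gt.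
  by move=> n; split => //; apply: open_measurable_rV; apply: ball_open.
case: m mf s => mu mc mf s.
pose m : {measure set 'rV[R]_d -> \bar R} := Measure.Pack mc.
pose H := Measure_isSigmaFinite.Build _ _ _ m s.
pose M : {sigma_finite_measure set 'rV[R]_d -> \bar R} := HB.pack mu m H.
by exists M.
Qed.

Lemma lebesgueRd_measure (d : nat) :
  exists m : {sigma_finite_measure set 'rV[R]_d -> \bar R},
  @lebesgueRd d = m /\
  (forall n : nat, (m (ball 0%R n.+1%:R) < +oo)%E).
Proof.
elim: d => [|d [m [mE mf]]].
  exists (\d_(0 : 'rV[R]_0)); split => // n.
  exact: ltry.
pose mu := pushforward (@lebesgue_measure R \x m)%E (@rowcons d).
have muf (n : nat) : (mu (ball (0 : 'rV[R]_d.+1)%R n.+1%:R) < +oo)%E.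
  rewrite /mu /pushforward (_ : _ @^-1` _ = ball (0 : R) n.+1%:R `*`
      ball (0 : 'rV[R]_d) n.+1%:R).
    rewrite product_measure1E//; last 2 first.
      exact: measurable_ball.
      by apply: open_measurable_rV; apply: ball_open.
    have e := @lebesgue_measure_ball R 0 n.+1%:R (ler0n _ _).
    apply: lte_mul_pinfty; [exact: measure_ge0| |exact: mf].
    by move: e => /= ->.
  have r0 : 0 = rowcons (0, 0) :> 'rV[R]_d.+1.
    apply/rowP => j; case: (unliftP ord0 j) => [k|] ->; rewrite mxE.
    by rewrite rowcons_tail mxE.
  by rewrite rowcons_head.
  apply/seteqP; split => [[x v] /=|[x v] /= xv]; rewrite r0.
    by move=> /rowcons_ball.
  exact/rowcons_ball.
pose mum : {measure set 'rV[R]_d.+1 -> \bar R} := mu.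
have [M ME] := @sigma_finite_balls _ (mum (@measurable_rowcons d)) muf.
by exists M; rewrite ME; split => //=; rewrite mE.
Qed.

Let lebesgueRd0 (d : nat) : @lebesgueRd d set0 = 0%E.
Proof. by have [m [-> _]] := lebesgueRd_measure d. Qed.

Let lebesgueRd_ge0 (d : nat) (A : set 'rV[R]_d) : (0 <= lebesgueRd A)%E.
Proof. by have [m [-> _]] := lebesgueRd_measure d. Qed.

Let lebesgueRd_sigma_additive (d : nat) : semi_sigma_additive (@lebesgueRd d).
Proof.
by have [m [-> _]] := lebesgueRd_measure d; exact: measure_semi_sigma_additive.
Qed.

HB.instance Definition _ (d : nat) := isMeasure.Build _ _ _ (@lebesgueRd d)
  (@lebesgueRd0 d) (@lebesgueRd_ge0 d) (@lebesgueRd_sigma_additive d).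

Let lebesgueRd_sigma_finite (d : nat) : sigma_finite setT (@lebesgueRd d).
Proof.
by have [m [-> _]] := lebesgueRd_measure d; exact: sigma_finiteT.
Qed.

HB.instance Definition _ (d : nat) := Measure_isSigmaFinite.Build _ _ _
  (@lebesgueRd d) (@lebesgueRd_sigma_finite d).

Lemma lebesgueRd_box (d : nat) (a b : 'rV[R]_d) :
  (forall i, a ord0 i <= b ord0 i) ->
  lebesgueRd [set x | forall i, x ord0 i \in `[a ord0 i, b ord0 i]] =
  (\prod_(i < d) (b ord0 i - a ord0 i))%:E.
Proof.
elim: d a b => [|d IH] a b ab.
  rewrite big_ord0 /= diracE mem_set//= => -[]//.
rewrite big_ord_recl; set S := mkset _.
pose tl (u : 'rV[R]_d.+1) : 'rV[R]_d := \row_j u ord0 (lift ord0 j).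
pose T := [set x : 'rV[R]_d | forall i, x ord0 i \in `[tl a ord0 i, tl b ord0 i]].
have -> : lebesgueRd S = (lebesgue_measure \x @lebesgueRd d)%E
    (`[a ord0 ord0, b ord0 ord0]%classic `*` T).
  congr ((lebesgue_measure \x @lebesgueRd d)%E : set _ -> _).
  apply/seteqP; split => -[x v] /=.
    move=> h; split=> [|i]; first by have := h ord0; rewrite rowcons_head.
    by have := h (lift ord0 i); rewrite rowcons_tail !mxE.
  move=> [hx hv] i; case: (unliftP ord0 i) => [k|] ->.
    by have := hv k; rewrite rowcons_tail !mxE.
  by rewrite rowcons_head.
rewrite product_measure1E//; last first.
  apply: closed_measurable_rV.
  rewrite (_ : T = \bigcap_i
      ((fun x : 'rV[R]_d => x ord0 i) @^-1` `[tl a ord0 i, tl b ord0 i])).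
    apply: closed_bigI => i _; apply: preimage_closed; last exact: itv_closed.
    by move=> x _; exact: coord_continuous.
  by apply/seteqP; split => [x h i _|x h i]; exact: h.
have tlab i : tl a ord0 i <= tl b ord0 i by rewrite !mxE.
apply: etrans (congr1 (mule _) (IH _ _ tlab)) _.
rewrite [X in (X * _)%E](lebesgue_measure_itv `[a ord0 ord0, b ord0 ord0])/=.
rewrite lte_fin.
have -> : \prod_(i < d) (tl b ord0 i - tl a ord0 i) =
    \prod_(i < d) (b ord0 (lift ord0 i) - a ord0 (lift ord0 i)).
  by apply: eq_bigr => i _; rewrite !mxE.
have := ab ord0; rewrite le_eqVlt => /orP[/eqP ->|->].
  by rewrite ltxx mul0e subrr mul0r.
by rewrite -EFinB -EFinM.
Qed.

End Lebesgue.

Section Energy.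
Context {R : realType} {d : nat}.
Implicit Types (x y c : 'rV[R]_d) (W : 'rV[R]_d -> \bar R).
Implicit Types (rho mu : probability 'rV[R]_d R) (A : set 'rV[R]_d).

(* The norm `|x| of 'rV[R]_d is the sup norm, hence this definition. *)
Definition enorm x : R := Num.sqrt (\sum_(i < d) x ord0 i ^+ 2).

Definition eball c (r : R) : set 'rV[R]_d := [set x | enorm (x - c) < r].

Definition at_infinity : set_system 'rV[R]_d :=
  [set A | \forall r \near +oo, forall x, r < enorm x -> A x].

Definition diam A : \bar R :=
  ereal_sup [set (enorm (x - y))%:E | x in A & y in A].

Definition loc_integrable W : Prop :=
  forall c (r : R), (\int[@lebesgueRd R d]_(x in eball c r) `|W x| < +oo)%E.

Definition energy W rho : \bar R :=
  (2^-1%:E * \int[rho \x rho]_z W (z.1 - z.2)%R)%E.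

Definition global_minimiser W rho : Prop :=
  forall mu, (energy W rho <= energy W mu)%E.

Definition msupport rho : set 'rV[R]_d :=
  [set x | forall U, open U -> U x -> (0 < rho U)%E].

Definition strictly_increasing_along W (k : 'I_d) (r : R) : Prop :=
  forall x y, (forall j, j != k -> x ord0 j = y ord0 j) ->
    r <= x ord0 k -> x ord0 k < y ord0 k -> (W x < W y)%E.

End Energy.

(* Main.v *)
Require Import Defs.
From mathcomp Require Import all_boot all_order all_algebra.
From mathcomp Require Import all_classical all_reals all_analysis.
From mathcomp Require Import measurable_realfun.
From mathcomp Require Import ring lra.

Set Implicit Arguments.
Unset Strict Implicit.
Unset Printing Implicit Defensive.
Import Order.TTheory GRing.Theory Num.Theory.
Import numFieldNormedType.Exports.
Local Open Scope classical_set_scope.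
Local Open Scope ring_scope.

(** Adding a constant to [W] turns it into a nonnegative potential [V] and
    shifts every energy by the same amount, so the object of study is
    [J rho], the integral of [V (x - y)] against [rho x rho].

    Minimisers cannot spread out. Let [rho] minimise [J] among the probability
    measures carried by the cube of sup-norm radius [n], where [n] may be
    infinite. Perturbing [rho] by a bounded density shows that its potential is
    at most [J rho] almost everywhere ([minimiser_potential_le]). Instability
    provides [J rho < L], where [L] is a lower bound of [V] outside a ball of
    radius [r]; the potential at [x] is at least [L] times the mass at distance
    [r] or more from [x], so almost every [x] sees a fixed amount of mass within
    distance [r] ([minimiser_concentration]). If a slab of width [2 R6]
    orthogonal to an axis separated [rho] into two pieces, moving one piece
    closer to the other by [R6] would strictly lower the energy, because [V]
    increases strictly along that axis beyond [R6] ([squeeze_gap]). Hence no slab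
    of that width between two typical points is empty, a slightly wider one
    contains a fixed amount of mass, and only boundedly many disjoint ones fit
    ([coord_spread_le]). The resulting bound
    [D] on the diameter does not depend on [n].

    Minimisers exist on a cube of finite radius by a compactness argument.
    Composing quantile functions with a space-filling curve represents the
    measures of a minimising sequence as laws of random variables on the unit
    interval. Quantile functions are monotone, so by Helly's theorem a
    subsequence converges almost everywhere, and by continuity of the curve so
    do the random variables ([box_compactness]). Fatou's lemma and the lower
    semicontinuity of [V] then bound the energy of the limit law.

    Finally, a minimiser on a large cube can be translated into the cube of
    radius [D] without changing its energy, so the minimal energy on cubes is
    eventually constant. Restricting an arbitrary measure to a cube of mass [p]
    and renormalising multiplies the energy by at most [p ^- 2], which tends to
    [1]: the constant is the global minimum ([minimiser_exists]). The bound on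
    the spread, applied with [n] infinite, gives the second assertion. *)

(** * Strict monotonicity of the integral *)

Section strict_comparison.
Local Open Scope ereal_scope.
Context dd (T : measurableType dd) (R : realType).
Variable mu : {measure set T -> \bar R}.

(** On [D] the function [f] is finite, so [g - f] is a positive function whose
    integral vanishes. *)
Lemma null_of_lt_integral (D : set T) (f g : T -> \bar R) : measurable D ->
  measurable_fun D f -> measurable_fun D g ->
  (forall x, D x -> 0 <= f x) -> (forall x, D x -> f x < g x) ->
  \int[mu]_(x in D) f x < +oo ->
  \int[mu]_(x in D) g x <= \int[mu]_(x in D) f x -> mu D = 0.
Proof.
move=> mD mf mg f0 fg foo gf.
have ffin x : D x -> f x \is a fin_num.
  move=> Dx; rewrite ge0_fin_numE ?f0//.
  by apply: lt_le_trans (fg x Dx) (leey _).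
pose h x := g x - f x.
have h0 x : D x -> 0 < h x by move=> Dx; rewrite sube_gt0 fg.
have mh : measurable_fun D h by apply: emeasurable_funB.
have hD : \int[mu]_(x in D) g x = \int[mu]_(x in D) f x + \int[mu]_(x in D) h x.
  rewrite -ge0_integralD//; last by move=> x Dx; rewrite ltW ?h0.
  by apply: eq_integral => x; rewrite inE => Dx; rewrite /h addeC subeK ?ffin.
have f0' : 0 <= \int[mu]_(x in D) f x by exact: integral_ge0.
have h00 : \int[mu]_(x in D) `|h x| = 0.
  transitivity (\int[mu]_(x in D) h x).
    by apply: eq_integral => x; rewrite inE => Dx; rewrite gee0_abs// ltW ?h0.
  apply/eqP; rewrite eq_le integral_ge0 ?andbT; last by move=> x Dx; rewrite ltW ?h0.
  move: gf; rewrite hD -[X in _ <= X]adde0 leeD2lE//.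
  by rewrite ge0_fin_numE.
have := ae_eq_integral_abs mu mD mh; case=> /(_ h00) [N [mN N0 sub]] _.
apply: subset_measure0 N0 => //.
apply: subset_trans sub => x Dx /=; apply/not_implyP; split => // hx.
by have := h0 x Dx; rewrite hx ltxx.
Qed.

Lemma null_of_le_integral (E D : set T) (f g : T -> \bar R) :
  measurable E -> measurable D -> D `<=` E ->
  measurable_fun E f -> measurable_fun E g -> (forall x, E x -> 0 <= f x) ->
  (forall x, E x -> f x <= g x) -> (forall x, D x -> f x < g x) ->
  \int[mu]_(x in E) f x < +oo ->
  \int[mu]_(x in E) g x <= \int[mu]_(x in E) f x -> mu D = 0.
Proof.
move=> mE mD DE mf mg f0 fg fgD foo gf.
have g0 x : E x -> 0 <= g x by move=> Ex; exact: le_trans (f0 x Ex) (fg x Ex).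
have mED : measurable (E `\` D) by exact: measurableD.
have EDE : E `\` D `<=` E by exact: subDsetl.
have mfD : measurable_fun D f by exact: measurable_funS mf.
have mgD : measurable_fun D g by exact: measurable_funS mg.
have split_int (h : T -> \bar R) : measurable_fun E h -> (forall x, E x -> 0 <= h x) ->
    \int[mu]_(x in E) h x = \int[mu]_(x in D) h x + \int[mu]_(x in E `\` D) h x.
  move=> mh h0; rewrite -{1}(setDUK DE) ge0_integral_setU ?setDUK//.
  by rewrite disj_set2E setDIK.
have fD : \int[mu]_(x in D) f x < +oo.
  by apply: le_lt_trans foo; apply: ge0_subset_integral.
apply: (@null_of_lt_integral D f g) => //; first by move=> x /DE; exact: f0.
have fC : \int[mu]_(x in E `\` D) f x < +oo.
  by apply: le_lt_trans foo; apply: ge0_subset_integral.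
move: gf; rewrite !split_int// => gf.
have ED0 : 0 <= \int[mu]_(x in E `\` D) f x by apply: integral_ge0 => x /EDE; exact: f0.
rewrite -(leeD2rE (x := \int[mu]_(x in E `\` D) f x)); last by rewrite ge0_fin_numE.
apply: le_trans gf; rewrite leeD2l//.
apply: ge0_le_integral => //.
- by move=> x /EDE; exact: f0.
- exact: measurable_funS mf.
- exact: measurable_funS mg.
- by move=> x /EDE; exact: fg.
Qed.

End strict_comparison.

(** * Interaction energies and their first variation *)

Section interaction.
Local Open Scope ereal_scope.
Context dd (T : measurableType dd) (R : realType).
Variable k : T * T -> \bar R.
Hypothesis mk : measurable_fun setT k.
Hypothesis k_ge0 : forall z, 0 <= k z.
Hypothesis k_sym : forall x y, k (x, y) = k (y, x).

Definition potential (mu : {measure set T -> \bar R}) (x : T) : \bar R :=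
  \int[mu]_y k (x, y).

Definition interaction (mu nu : {measure set T -> \bar R}) : \bar R :=
  \int[mu]_x potential nu x.

Lemma potential_ge0 mu x : 0 <= potential mu x.
Proof. exact: integral_ge0. Qed.

Lemma interaction_ge0 mu nu : 0 <= interaction mu nu.
Proof. by apply: integral_ge0 => x _; exact: potential_ge0. Qed.

Lemma measurable_kernel_section x : measurable_fun setT (fun y => k (x, y)).
Proof. exact: measurableT_comp. Qed.

Lemma measurable_potential (mu : {finite_measure set T -> \bar R}) :
  measurable_fun setT (potential mu).
Proof. exact: (@measurable_fun_fubini_tonelli_F _ _ _ _ _ mu k). Qed.

Lemma interactionC (mu nu : {finite_measure set T -> \bar R}) :
  interaction mu nu = interaction nu mu.
Proof.
rewrite /interaction /potential (fubini_tonelli k)//.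
by apply: eq_integral => x _; apply: eq_integral => y _.
Qed.

Lemma interactionE (mu : {finite_measure set T -> \bar R}) :
  interaction mu mu = \int[mu \x mu]_z k z.
Proof. by rewrite fubini_tonelli1. Qed.

Lemma normalize_exists (P : probability T R) (m : {measure set T -> \bar R}) (t : R) :
  (0 < t)%R -> m setT = t%:E ->
  exists nu : probability T R, forall A, m A = t%:E * nu A.
Proof.
move=> t0 mt; exists (mnormalize m P) => A.
rewrite /= /mnormalize mt ifF; last by rewrite eqe gt_eqF.
by rewrite muleCA -EFinM divff ?gt_eqF// mule1.
Qed.

Lemma interaction_normalize (m : {measure set T -> \bar R}) (t : R)
    (nu : probability T R) : (0 < t)%R -> (forall A, m A = t%:E * nu A) ->
  interaction m m = (t ^+ 2)%:E * interaction nu nu.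
Proof.
move=> t0 mE; pose s : {nonneg R} := NngNum (ltW t0).
have int_m f : measurable_fun setT f -> (forall x, 0 <= f x) ->
    \int[m]_x f x = t%:E * \int[nu]_x f x.
  move=> mf f0; rewrite -[t]/(s%:num) -ge0_integral_mscale//.
  by apply: eq_measure_integral => A _ _; exact: mE.
have pot_m : potential m = fun x => t%:E * potential nu x.
  by apply/funext => x; apply: int_m => //; exact: measurable_kernel_section.
have mp := measurable_potential nu.
rewrite /interaction pot_m int_m; last 2 first.
- exact: measurable_funeM.
- by move=> x; rewrite mule_ge0 ?potential_ge0// lee_fin ltW.
rewrite ge0_integralZl_EFin ?(ltW t0)//; last by move=> x _; exact: potential_ge0.
by rewrite muleA -EFinM -expr2.
Qed.

(** Quadratic expansion of the energy of the normalised density [1 + c 1_B]. This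
    density is positive, so no signed measure enters, and absolute continuity
    keeps the competitor inside any class defined by a null set. *)
Lemma interaction_perturb (rho : probability T R) (B : set T) (mB : measurable B)
    (c : {nonneg R}) :
  exists nu : probability T R,
    (forall A, measurable A -> rho A = 0 -> nu A = 0) /\
    ((1 + c%:num * fine (rho B)) ^+ 2)%R%:E * interaction nu nu =
    interaction rho rho + (2 * c%:num)%R%:E * interaction (mrestr rho mB) rho +
    (c%:num ^+ 2)%R%:E * interaction (mrestr rho mB) (mrestr rho mB).
Proof.
pose rB := mrestr rho mB.
pose m := measure_add rho (mscale c rB).
have t_gt0 : (0 < 1 + c%:num * fine (rho B))%R.
  by rewrite ltr_pwDl// mulr_ge0// fine_ge0.
set t := (1 + _)%R in t_gt0 *.
have mE A : m A = rho A + c%:num%:E * rho (A `&` B) by rewrite /m measure_addE.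
have mT : m setT = t%:E.
  by rewrite mE setTI probability_setT EFinD EFinM fineK// fin_num_measure.
have [nu nuE] := normalize_exists rho t_gt0 mT.
have int_m f : measurable_fun setT f -> (forall x, 0 <= f x) ->
    \int[m]_x f x = \int[rho]_x f x + c%:num%:E * \int[rB]_x f x.
  by move=> mf f0; rewrite ge0_integral_measure_add// ge0_integral_mscale.
have pot_m x : potential m x = potential rho x + c%:num%:E * potential rB x.
  by apply: int_m => //; exact: measurable_kernel_section.
have mpot_m : measurable_fun setT (potential m).
  rewrite (_ : potential m = fun x => potential rho x + c%:num%:E * potential rB x).
    by apply: emeasurable_funD; [|apply: measurable_funeM]; exact: measurable_potential.
  exact/funext.
exists nu; split.
  move=> A mA rA; have := etrans (esym (nuE A)) (mE A); rewrite rA add0e.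
  rewrite (_ : rho (A `&` B) = 0) ?mule0; last first.
    by apply: subset_measure0 rA => //; exact: measurableI.
  by move/eqP; rewrite mule_eq0 eqe gt_eqF//= => /eqP.
rewrite -(interaction_normalize t_gt0 nuE).
have pB0 x : 0 <= c%:num%:E * potential rB x.
  by rewrite mule_ge0// potential_ge0.
have mpB : measurable_fun setT (fun x => c%:num%:E * potential rB x).
  by apply: measurable_funeM; exact: measurable_potential.
have split_int (n : {finite_measure set T -> \bar R}) : \int[n]_x potential m x =
    interaction n rho + c%:num%:E * interaction n rB.
  under eq_integral do rewrite pot_m.
  rewrite ge0_integralD//.
  - rewrite ge0_integralZl_EFin//.
    + by move=> x _; exact: potential_ge0.
    + exact: measurable_potential.
  - by move=> x _; exact: potential_ge0.
  - exact: measurable_potential.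
rewrite {1}/interaction int_m//; last by move=> x; exact: potential_ge0.
have alg (u v w : \bar R) : 0 <= v -> 0 <= w ->
    (u + c%:num%:E * v) + c%:num%:E * (v + c%:num%:E * w) =
    u + (2 * c%:num)%R%:E * v + (c%:num ^+ 2)%R%:E * w.
  move=> v0 w0; rewrite ge0_muleDr ?mule_ge0// muleA -EFinM -expr2.
  rewrite addeA -(addeA u); congr (u + _ + _).
  by rewrite mulr_natl mulr2n EFinD ge0_muleDl// lee_fin.
rewrite !split_int (interactionC rho rB) alg//; exact: interaction_ge0.
Qed.

Lemma ge0_integral_mrestrU (mu : {finite_measure set T -> \bar R}) (B : set T)
    (mB : measurable B) (f : T -> \bar R) :
  measurable_fun setT f -> (forall x, 0 <= f x) ->
  \int[mu]_x f x =
  \int[mrestr mu mB]_x f x + \int[mrestr mu (measurableC mB)]_x f x.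
Proof.
move=> mf f0; rewrite -ge0_integral_measure_add//.
apply: eq_measure_integral => A mA _.
apply: etrans (esym (measure_addE _ _ _)); apply: etrans (measureU _ _ _ _).
- by rewrite -setIUr setUv setIT.
- exact: measurableI.
- by apply: measurableI => //; exact: measurableC.
- by rewrite setIACA setICr setI0.
Qed.

Lemma interaction_mrestr_le (mu nu : {finite_measure set T -> \bar R}) (B : set T)
  (mB : measurable B) : interaction (mrestr mu mB) nu <= interaction mu nu.
Proof.
rewrite [leRHS](ge0_integral_mrestrU mu mB) ?leeDl ?interaction_ge0//.
- exact: measurable_potential.
- by move=> x; exact: potential_ge0.
Qed.

Lemma interaction_pushforward d0 (S : measurableType d0) (P : probability S R)
    (X : S -> T) (nu : probability T R) : measurable_fun setT X ->
  (forall A, measurable A -> nu A = P (X @^-1` A)) ->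
  interaction nu nu = \int[P]_s \int[P]_t k (X s, X t).
Proof.
move=> mX nuE.
have int_nu f : measurable_fun setT f -> (forall x, 0 <= f x) ->
    \int[nu]_x f x = \int[P]_s f (X s).
  move=> mf f0.
  transitivity (\int[pushforward P X]_x f x); last exact: ge0_integral_pushforward.
  by apply: eq_measure_integral => A mA _; exact: nuE.
rewrite /interaction int_nu; last 2 first.
- exact: measurable_potential.
- by move=> x; exact: potential_ge0.
apply: eq_integral => s _; apply: int_nu => //; exact: measurable_kernel_section.
Qed.

Section euler_lagrange.
Variable rho : probability T R.
Hypothesis rho_fin : interaction rho rho < +oo.
Hypothesis rho_min : forall nu : probability T R,
  (forall A, measurable A -> rho A = 0 -> nu A = 0) ->
  interaction rho rho <= interaction nu nu.

(** Compare the terms of order [c] in [interaction_perturb] as [c] tends to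
    [0]. *)
Lemma minimiser_first_variation (B : set T) (mB : measurable B) :
  rho B * interaction rho rho <= interaction (mrestr rho mB) rho.
Proof.
have le1 : interaction (mrestr rho mB) rho <= interaction rho rho.
  exact: interaction_mrestr_le.
have le2 : interaction (mrestr rho mB) (mrestr rho mB) <= interaction (mrestr rho mB) rho.
  by rewrite [leRHS]interactionC; exact: interaction_mrestr_le.
have fin mu nu : interaction mu nu <= interaction rho rho ->
    interaction mu nu \is a fin_num.
  by move=> h; rewrite ge0_fin_numE ?interaction_ge0//; exact: le_lt_trans rho_fin.
have pert := interaction_perturb rho mB.
move: (fin _ _ (lexx _)) (fin _ _ le1) (fin _ _ (le_trans le2 le1)) pert => + + + pert.
have : rho B \is a fin_num by exact: fin_num_measure.
have minE (c : {nonneg R}) : (((1 + c%:num * fine (rho B)) ^+ 2)%R%:E *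
     interaction rho rho <=
    interaction rho rho + (2 * c%:num)%R%:E * interaction (mrestr rho mB) rho +
    (c%:num ^+ 2)%R%:E * interaction (mrestr rho mB) (mrestr rho mB)).
  have [nu [nu_ll <-]] := pert c.
  by rewrite lee_wpmul2l ?lee_fin ?sqr_ge0// rho_min.
move: minE; clear pert le1 le2 fin rho_min.
have := interaction_ge0 (mrestr rho mB) (mrestr rho mB).
have := interaction_ge0 rho rho.
set q' := interaction (mrestr rho mB) (mrestr rho mB).
set i' := interaction (mrestr rho mB) rho.
set j' := interaction rho rho.
move: (rho B) q' i' j' => b' q' i' j' + + + /fineK bE /fineK jE /fineK iE /fineK qE.
rewrite -bE -jE -iE -qE; move: (fine b') (fine q') (fine i') (fine j') => b q i j.
rewrite !lee_fin => j0 q0 minE.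
apply/ler_addgt0Pr => e e0.
have q1 : (0 < q + 1)%R by rewrite ltr_wpDl.
(* the quadratic term [c q] then contributes less than [e] *)
pose c := (e / (q + 1))%R.
have c0 : (0 < c)%R by rewrite divr_gt0.
have cq : (c * q <= e)%R.
  by rewrite -(divfK (lt0r_neq0 q1) e) -/c ler_pM2l// lerDl.
have := minE (NngNum (ltW c0)); rewrite -!EFinM -!EFinD lee_fin/= => h.
have {}h : (c * (2 * (b * j)) <= c * (2 * i + c * q))%R.
  have : (0 <= (c * b) ^+ 2 * j)%R by rewrite mulr_ge0// sqr_ge0.
  nra.
move: h; rewrite ler_pM2l//; lra.
Qed.

(** The Euler-Lagrange inequality: apply the first variation to the complement
    of the set where the potential exceeds the energy. Since the potential
    integrates to the energy, what is left on that set is too small for the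
    strict inequality to hold on a non-null set. *)
Lemma minimiser_potential_le :
  rho [set x | interaction rho rho < potential rho x] = 0.
Proof.
set A := [set x | _].
have mp : measurable_fun setT (potential rho) by exact: measurable_potential.
have mA : measurable A.
  by rewrite -[A]setTI; apply: emeasurable_fun_o_infty.
pose rA := mrestr rho mA.
have fin1 : interaction rho rho \is a fin_num.
  by rewrite ge0_fin_numE// interaction_ge0.
have rAA : rA A = rho A by rewrite /rA /mrestr/= setIid.
have cstE : \int[rA]_(x in A) cst (interaction rho rho) x = interaction rho rho * rho A.
  by rewrite -(fineK fin1) integral_cst//; congr mule; exact: rAA.
rewrite -rAA.
apply: (@null_of_lt_integral _ _ _ rA A (cst (interaction rho rho)) (potential rho)) => //.
- exact: measurable_funS mp.
- by move=> x _; exact: interaction_ge0.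
- rewrite cstE ltey_eq; apply/orP; left.
  by rewrite fin_numM// fin_num_measure.
rewrite cstE.
apply: (@le_trans _ _ (interaction rA rho)).
  by apply: ge0_subset_integral => // x _; exact: potential_ge0.
have mAC := measurableC mA.
have := minimiser_first_variation mAC.
have : interaction rho rho = interaction rA rho + interaction (mrestr rho mAC) rho.
  by apply: ge0_integral_mrestrU => // x; exact: potential_ge0.
have le2 : interaction (mrestr rho mAC) rho <= interaction rho rho.
  exact: interaction_mrestr_le.
have le1 : interaction rA rho <= interaction rho rho.
  exact: interaction_mrestr_le.
have fin2 : interaction rA rho \is a fin_num.
  by rewrite ge0_fin_numE ?interaction_ge0//; exact: le_lt_trans rho_fin.
have fin3 : interaction (mrestr rho mAC) rho \is a fin_num.
  by rewrite ge0_fin_numE ?interaction_ge0//; exact: le_lt_trans rho_fin.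
rewrite probability_setC//.
have : rho A \is a fin_num by exact: fin_num_measure.
move: fin1 fin2 fin3.
set i2 := interaction (mrestr rho mAC) rho.
set i1 := interaction rA rho.
set j := interaction rho rho.
move=> /fineK <- /fineK <- /fineK <- /fineK <-.
rewrite !lee_fin => e1 e2; have /= {}e1 := congr1 fine e1; lra.
Qed.

End euler_lagrange.

End interaction.

Lemma pushforward_exists dS dT (S : measurableType dS) (T : measurableType dT)
    (R : realType) (P : probability S R) (X : S -> T) : measurable_fun setT X ->
  exists nu : probability T R, forall A, nu A = P (X @^-1` A).
Proof.
move=> mX; pose X' : {mfun S >-> T} := mfun_Sub (mem_set mX).
by exists (distribution P X').
Qed.

(** * Borel measurability of vector-valued maps *)

Section borel_rV.
Context {R : realType} {d : nat}.

Lemma measurable_coord (j : 'I_d) :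
  measurable_fun setT (fun x : 'rV[R]_d => x ord0 j).
Proof.
apply: (measurability _ (RGenOpens.measurableE R)).
move=> _ [_ [a [b ->] <-]]; rewrite setTI; apply: open_measurable_rV.
by apply: open_comp => // x _; exact: coord_continuous.
Qed.

(** A second-countability argument: every open set is a union of the countably
    many balls with rational centre and radius [1/(n+1)] it contains, and such
    a ball is a finite intersection of coordinate slabs. *)
Lemma measurable_fun_rV dd (T : measurableType dd) (f : T -> 'rV[R]_d) :
  (forall j, measurable_fun setT (fun x => f x ord0 j)) -> measurable_fun setT f.
Proof.
move=> mf; apply: (measurability (@open 'rV[R]_d)) => // _ [U oU <-]; rewrite setTI.
pose B (i : 'rV[rat]_d * nat) : set 'rV[R]_d :=
  if `[< ball (map_mx ratr i.1 : 'rV[R]_d) i.2.+1%:R^-1 `<=` U >]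
  then ball (map_mx ratr i.1 : 'rV[R]_d) i.2.+1%:R^-1 else set0.
suff -> : U = \bigcup_i B i.
  rewrite preimage_bigcup; apply: countable_bigcupT_measurable => // -[u n].
  rewrite /B/=; case: asboolP => _; last by rewrite preimage_set0.
  rewrite (_ : _ @^-1` _ = \bigcap_(j in [set: 'I_d])
     ((fun x => f x ord0 j) @^-1` ball (ratr (u ord0 j) : R) n.+1%:R^-1)).
    apply: fin_bigcap_measurable => // j _; rewrite -[_ @^-1` _]setTI.
    by apply: mf => //; exact: measurable_ball.
  apply/seteqP; split => [x [_ /= h] j _|x /= h].
    by have := h ord0 j; rewrite mxE.
  by split => // i j; rewrite ord1 mxE; exact: h.
apply/seteqP; split => [v Uv|v [[u n] _]]; last first.
  by rewrite /B/=; case: asboolP => // h /h.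
have /nbhs_ballP[e /= e0 eU] : nbhs v U by apply: open_nbhs_nbhs; split.
have [n ne] : exists n : nat, n.+1%:R^-1 < e / 2.
  have e20 : 0 < e / 2 by rewrite divr_gt0.
  have /filter_ex[n hn] := near_infty_natSinv_lt (PosNum e20).
  by exists n.
have rq (y : R) : exists q : rat, ball (ratr q : R) n.+1%:R^-1 y.
  have /rat_in_itvoo[q] : y < y + n.+1%:R^-1 by rewrite ltrDl invr_gt0.
  rewrite in_itv/= => /andP[yq qy]; exists q.
  by rewrite /ball/= ger0_norm ?subr_ge0 ?(ltW yq)// ltrBlDl.
have [q vq] := choice (fun j => rq (v ord0 j)).
have vu : ball (map_mx ratr (\row_j q j) : 'rV[R]_d) n.+1%:R^-1 v.
  by split; [rewrite invr_gt0|move=> i j; rewrite !mxE ord1; exact: vq].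
exists (\row_j q j, n) => //; rewrite /B/= asboolT// => w hw; apply: eU.
rewrite [e]splitr; apply: ball_triangle (le_ball (ltW ne) hw).
by apply: (le_ball (ltW ne)); exact: ball_sym.
Qed.

Lemma measurable_rV_sub dd (T : measurableType dd) (f g : T -> 'rV[R]_d) :
  measurable_fun setT f -> measurable_fun setT g ->
  measurable_fun setT (fun x => f x - g x).
Proof.
move=> mf mg; apply: measurable_fun_rV => j.
rewrite (_ : (fun x => _) = (fun x => f x ord0 j) \- (fun x => g x ord0 j)).
  by apply: measurable_funB; apply: (measurableT_comp (measurable_coord j)).
by apply/funext => x; rewrite !mxE.
Qed.

Lemma measurable_rV_diff :
  measurable_fun setT (fun z : 'rV[R]_d * 'rV[R]_d => z.1 - z.2).
Proof. by apply: measurable_rV_sub. Qed.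

End borel_rV.

(** * Concentration of minimisers, and their lack of gaps *)

Section rV_norm.
Context {R : realType} {d : nat}.
Implicit Types (x y : 'rV[R]_d).

Lemma coord_le_norm x j : `|x ord0 j| <= `|x|.
Proof.
rewrite [leRHS]/Num.norm/= mx_normrE.
by apply/bigmax_geP; right; exists (ord0, j).
Qed.

Lemma rV_norm_le x (c : R) : 0 <= c -> (forall j, `|x ord0 j| <= c) -> `|x| <= c.
Proof.
move=> c0 h; rewrite [leLHS]/Num.norm/= mx_normrE.
by apply/bigmax_leP; split => // -[i j] _ /=; rewrite ord1.
Qed.

Lemma in_ball_rV x y r : ball x r y = (`|x - y| < r) :> Prop.
Proof. by rewrite mx_norm_ball. Qed.

Lemma ball_coord x y r j : ball x r y -> x ord0 j - r < y ord0 j < x ord0 j + r.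
Proof.
rewrite in_ball_rV => h; have := le_lt_trans (coord_le_norm (x - y) j) h.
by rewrite !mxE ltr_distlC => /andP[? ?]; apply/andP; split; lra.
Qed.

End rV_norm.

Section slab.
Context {R : realType} {d : nat}.

Definition slab (j : 'I_d) (i : interval R) : set 'rV[R]_d :=
  [set x | x ord0 j \in i].

Lemma measurable_slab j (i : interval R) : measurable (slab j i).
Proof.
rewrite -[X in measurable X]setTI.
have := @measurable_coord R d j measurableT [set` i].
by apply; exact: measurable_itv.
Qed.

End slab.

Section minimiser_diameter.
Context {R : realType} {d : nat}.
Variable V : 'rV[R]_d -> \bar R.
Hypothesis mV : measurable_fun setT V.
Hypothesis V_ge0 : forall x, (0 <= V x)%E.
Hypothesis V_even : forall x, V x = V (- x).

Definition difference_kernel (z : 'rV[R]_d * 'rV[R]_d) : \bar R := V (z.1 - z.2).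
Local Notation k := difference_kernel.
Local Notation J rho := (interaction difference_kernel rho rho).

Lemma measurable_difference_kernel : measurable_fun setT k.
Proof. exact: measurableT_comp measurable_rV_diff. Qed.
Let mk := measurable_difference_kernel.

Lemma difference_kernel_ge0 z : (0 <= k z)%E. Proof. exact: V_ge0. Qed.
Let k_ge0 := difference_kernel_ge0.

Lemma difference_kernel_sym x y : k (x, y) = k (y, x).
Proof. by rewrite /k/= V_even opprB. Qed.
Let k_sym := difference_kernel_sym.

Lemma potential_ge_far_mass (rho : probability 'rV[R]_d R) (L r : R) x : 0 <= L ->
  (forall z, r <= `|z| -> (L%:E <= V z)%E) ->
  (L%:E * rho (~` ball x r) <= potential k rho x)%E.
Proof.
move=> L0 hL.
have mB : measurable (~` ball x r).
  apply: measurableC; case: (ltP 0 r) => r0.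
    by apply: open_measurable_rV; apply: ball_open.
  suff -> : ball x r = set0 by [].
  by apply/seteqP; split => // y [] /=; rewrite ltNge r0.
rewrite -(integral_cst rho mB).
apply: (@le_trans _ _ (\int[rho]_(y in ~` ball x r) k (x, y))%E).
  apply: ge0_le_integral => //.
  - by apply: measurable_funS (measurable_kernel_section mk x).
  - move=> y /=; rewrite in_ball_rV => /negP; rewrite -leNgt => h.
    exact: hL.
apply: ge0_subset_integral => //; exact: measurable_kernel_section.
Qed.

Lemma minimiser_concentration (rho : probability 'rV[R]_d R) (J0 L r : R) :
  (forall nu : probability 'rV[R]_d R,
    (forall A, measurable A -> rho A = 0 -> nu A = 0) -> J rho <= J nu)%E ->
  (J rho <= J0%:E)%E -> 0 < L -> (forall z, r <= `|z| -> (L%:E <= V z)%E) -> 0 < r ->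
  exists Z, [/\ measurable Z, rho Z = 0%E &
    forall x, ~ Z x -> ((1 - J0 / L)%:E <= rho (ball x r))%E].
Proof.
move=> rho_min rhoJ0 L0 hL r0.
have rho_fin : (J rho < +oo)%E by apply: le_lt_trans rhoJ0 (ltry _).
exists [set x | J rho < potential k rho x]%E; split.
- rewrite -[X in measurable X]setTI; apply: emeasurable_fun_o_infty => //.
  exact: measurable_potential.
- exact: minimiser_potential_le.
move=> x /negP; rewrite -leNgt => hx.
have := potential_ge_far_mass rho x (ltW L0) hL.
have mB : measurable (ball x r) by apply: open_measurable_rV; exact: ball_open.
move=> /le_trans/(_ hx)/le_trans/(_ rhoJ0).
have : rho (ball x r) \is a fin_num by exact: fin_num_measure.
rewrite probability_setC// => /fineK <-; rewrite !lee_fin.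
by rewrite -ler_pdivlMl// => h; rewrite lerBlDr -lerBlDl (le_trans h)// mulrC.
Qed.

(** Narrows an empty slab of which [b] is the upper face: only the points beyond
    it move. *)
Definition squeeze (j : 'I_d) (b s : R) (x : 'rV[R]_d) : 'rV[R]_d :=
  \row_i (if (i == j) && (b <= x ord0 j) then x ord0 i - s else x ord0 i).

Lemma measurable_squeeze j b s : measurable_fun setT (squeeze j b s).
Proof.
apply: measurable_fun_rV => i; have [->|ij] := eqVneq i j; last first.
  rewrite (_ : (fun x => _) = fun x : 'rV[R]_d => x ord0 i); first exact: measurable_coord.
  by apply/funext => x; rewrite mxE (negbTE ij).
rewrite (_ : (fun x => _) =
    (fun t => t - s * \1_(`[b, +oo[%classic) t) \o (fun x : 'rV[R]_d => x ord0 j)).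
  apply: (measurableT_comp _ (measurable_coord j)).
  have mi : measurable_fun setT (\1_(`[b, +oo[%classic : set R) : R -> R).
    by apply: measurable_indic; exact: measurable_itv.
  by apply: measurable_funB => //; apply: measurable_funM.
apply/funext => x; rewrite mxE eqxx/= indicE.
by rewrite mem_setE in_itv/= andbT; case: ifP; rewrite ?mulr1 ?mulr0 ?subr0.
Qed.

Section no_gap.
Variables (rho : probability 'rV[R]_d R) (j : 'I_d) (a b s r6 : R).
Hypothesis V_incr : strictly_increasing_along V j r6.
Hypothesis s_gt0 : 0 < s.
Hypothesis a_b_s : a + s + r6 <= b.
Hypothesis r6_ge0 : 0 <= r6.
Let T := squeeze j b s.

Let gapless := [set x : 'rV[R]_d | x ord0 j <= a \/ b <= x ord0 j].

Let squeeze_left (x : 'rV[R]_d) : x ord0 j <= a -> T x = x.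
Proof.
move=> xa; apply/rowP => i; rewrite mxE (leNgt b) (_ : _ < b) ?andbF//.
by move: (s_gt0) (a_b_s) (r6_ge0) => ? ? ?; lra.
Qed.

Let squeeze_apart (x y : 'rV[R]_d) : b <= x ord0 j -> y ord0 j <= a ->
  (V (T x - T y) < V (x - y))%E.
Proof.
move=> bx ya; rewrite (squeeze_left ya); apply: V_incr => [i ij||].
- by rewrite !mxE (negbTE ij).
- by rewrite !mxE eqxx bx/=; move: (s_gt0) (a_b_s) (r6_ge0) => ? ? ?; lra.
- by rewrite !mxE eqxx bx/=; move: (s_gt0) (a_b_s) (r6_ge0) => ? ? ?; lra.
Qed.

Let squeeze_le x y : gapless x -> gapless y -> (V (T x - T y) <= V (x - y))%E.
Proof.
move=> [xa|xb] [ya|yb].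
- by rewrite !squeeze_left.
- by rewrite V_even (V_even (x - y)) !opprB; exact/ltW/squeeze_apart.
- exact/ltW/squeeze_apart.
- rewrite (_ : T x - T y = x - y)//; apply/rowP => i; rewrite !mxE xb yb !andbT.
  by case: eqP => // ->; lra.
Qed.

(** Squeezing leaves the mutual distances inside each of the two pieces
    unchanged and strictly decreases [V (x - y)] when [x] and [y] lie in
    different pieces: points that were at least [s + r6] apart remain at least
    [r6] apart. So if the energy does not drop, one of the pieces is null. *)
Lemma squeeze_gap : (J rho < +oo)%E ->
  (forall nu : probability 'rV[R]_d R, (forall A, nu A = rho (T @^-1` A)) ->
    J rho <= J nu)%E ->
  rho (slab j `]a, b[) = 0%E ->
  rho (slab j `[b, +oo[) = 0%E \/ rho (slab j `]-oo, a]) = 0%E.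
Proof.
move=> rho_fin rho_min gap0.
have mT : measurable_fun setT T by exact: measurable_squeeze.
have [nu nuE] := pushforward_exists rho mT.
have mTT : measurable_fun setT (fun z : 'rV[R]_d * 'rV[R]_d => (T z.1, T z.2)).
  apply: measurable_fun_pair.
  - exact: (measurableT_comp mT measurable_fst).
  - exact: (measurableT_comp mT measurable_snd).
pose f z := k (T z.1, T z.2).
have mf : measurable_fun setT f by exact: measurableT_comp mTT.
have Jnu : J nu = (\int[rho \x rho]_z f z)%E.
  rewrite (interaction_pushforward mk k_ge0 mT (fun A _ => nuE A)).
  by rewrite fubini_tonelli1// => z; exact: k_ge0.
have {rho_min} : (J rho <= J nu)%E by exact: rho_min.
rewrite Jnu => rho_min.
have slabE : gapless = ~` (slab j `]a, b[).
  apply/seteqP; split => x /=; rewrite /slab/= in_itv/=.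
    by case=> h; apply/negP; rewrite negb_and -!leNgt h ?orbT.
  by move/negP; rewrite negb_and -!leNgt => /orP.
have mgap : measurable gapless by rewrite slabE; apply: measurableC; exact: measurable_slab.
pose E := gapless `*` gapless.
have mE : measurable E by exact: measurableX.
have gapC0 : rho (~` gapless) = 0%E by rewrite slabE setCK.
have EC0 : (rho \x rho)%E (~` E) = 0%E.
  apply: (@subset_measure0 _ _ _ _ _ ((~` gapless `*` setT) `|` (setT `*` ~` gapless))).
  - exact: measurableC.
  - by apply: measurableU; apply: measurableX; rewrite //; exact: measurableC.
  - move=> [x y] /= /not_andP[h|h]; [left|right] => //.
  - have mgapC := measurableC mgap.
    apply: null_set_setU; [exact: measurableX|exact: measurableX| |].
    + apply: etrans (product_measure1E rho rho mgapC measurableT) _.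
      by rewrite [X in (X * _)%E](_ : _ = 0%E) ?mul0e.
    + apply: etrans (product_measure1E rho rho measurableT mgapC) _.
      by rewrite [X in (_ * X)%E](_ : _ = 0%E) ?mule0.
pose D := slab j `[b, +oo[ `*` slab j `]-oo, a].
have mD : measurable D by apply: measurableX; exact: measurable_slab.
have intE h : measurable_fun setT h -> (forall z, 0 <= h z)%E ->
    (\int[rho \x rho]_z h z = \int[rho \x rho]_(z in E) h z)%E.
  move=> mh h0; rewrite (ge0_negligible_integral _ _ _ _ EC0)//.
  - by rewrite setTD setCK.
  - exact: measurableC.
have fk z : E z -> (f z <= k z)%E by move=> [z1 z2]; exact: squeeze_le.
have rho_min' : (\int[rho \x rho]_(z in E) k z <= \int[rho \x rho]_(z in E) f z)%E.
  rewrite -intE// -[leRHS]intE//; last by move=> z; exact: k_ge0.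
  by rewrite -(interactionE mk k_ge0).
suff : (rho \x rho)%E D = 0%E.
  move=> D0; have := product_measure1E rho rho (measurable_slab j `[b, +oo[)
    (measurable_slab j `]-oo, a]).
  by move/(etrans (esym D0))/esym/eqP; rewrite mule_eq0 => /orP[]/eqP; [left|right].
apply: (null_of_le_integral mE mD _ _ _ _ fk) rho_min' => //.
- move=> [x y] [] /=; rewrite /slab/= !in_itv/= andbT => xb ya.
  by split; [right|left].
- exact: measurable_funS mf.
- exact: measurable_funS mk.
- by move=> z _; exact: k_ge0.
- by move=> [x y] [] /=; rewrite /slab/= !in_itv/= andbT => xb ya; exact: squeeze_apart.
- apply: (@le_lt_trans _ _ (J rho)) => //; rewrite (interactionE mk k_ge0) intE//.
  apply: ge0_le_integral => //.
  + by move=> z _; exact: k_ge0.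
  + exact: measurable_funS mf.
  + exact: measurable_funS mk.
Qed.

End no_gap.

End minimiser_diameter.

Section spread.
Context {R : realType} {d : nat}.
Variables (rho : probability 'rV[R]_d R) (Z : set 'rV[R]_d) (j : 'I_d) (m r g : R).
Hypothesis rhoZ : rho Z = 0%E.
Hypothesis mZ : measurable Z.
Hypothesis m_gt0 : 0 < m.
Hypothesis r_gt0 : 0 < r.
Hypothesis g_gt0 : 0 < g.
Hypothesis concentrated : forall x, ~ Z x -> (m%:E <= rho (ball x r))%E.
Hypothesis gapless : forall a,
  rho (slab j `]a, a + g[) = 0%E ->
  rho (slab j `[a + g, +oo[) = 0%E \/ rho (slab j `]-oo, a]) = 0%E.

Let F t := rho (slab j `]-oo, t[).

(** Induction on the number of slabs of width [g + 2 r] between [x] and [y].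
    The central part of width [g] of each slab has positive mass, hence contains
    a typical point [z]; the margins [r] on both sides keep [ball z r] inside
    the slab. *)
Lemma mass_below_ge (x y : 'rV[R]_d) (n : nat) : ~ Z x -> ~ Z y ->
  x ord0 j + r + n%:R * (g + 2 * r) <= y ord0 j - r ->
  ((n%:R * m)%:E <= F (x ord0 j + r + n%:R * (g + 2 * r)))%E.
Proof.
move=> Zx Zy; elim: n => [|n IH] hn; first by rewrite mul0r.
set t := x ord0 j + r + n%:R * (g + 2 * r) in IH.
have n0 : 0 <= n%:R * (g + 2 * r).
  by rewrite mulr_ge0//; move: g_gt0 r_gt0 => ? ?; lra.
have tE : x ord0 j + r + n.+1%:R * (g + 2 * r) = t + (g + 2 * r).
  by rewrite -natr1 /t; ring.
rewrite tE in hn *.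
have mball (z : 'rV[R]_d) : measurable (ball z r).
  by apply: open_measurable_rV; exact: ball_open.
have pos z (A : set 'rV[R]_d) : ~ Z z -> measurable A -> ball z r `<=` A ->
    rho A != 0%E.
  move=> Zz mA zA; rewrite gt_eqF//.
  apply: (@lt_le_trans _ _ m%:E); first by rewrite lte_fin.
  by apply: le_trans (concentrated Zz) _; apply: le_measure; rewrite ?inE.
have slab0 : rho (slab j `](t + r), (t + r + g)[) != 0%E.
  apply/negP => /eqP /gapless[] /eqP; apply/negP.
  - apply: (pos y) => //; first exact: measurable_slab.
    move=> z /(ball_coord j) /andP[? ?]; rewrite /= /slab/= in_itv/= andbT.
    by move: r_gt0 g_gt0 => ? ?; lra.
  - apply: (pos x) => //; first exact: measurable_slab.
    move=> z /(ball_coord j) /andP[? ?]; rewrite /= /slab/= in_itv/=.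
    by rewrite /t; move: r_gt0 g_gt0 => ? ?; lra.
have [z [zs Zz]] : exists z, slab j `](t + r), (t + r + g)[ z /\ ~ Z z.
  apply/not_existsP => h; move/negP: slab0; apply; apply/eqP.
  apply: subset_measure0 rhoZ => //; first exact: measurable_slab.
  by move=> z zs; apply: contrapT => Zz; exact: (h z).
move: zs; rewrite /slab/= in_itv/= => /andP[tz zt].
have FU : (F t + rho (ball z r) <= F (t + (g + 2 * r)))%E.
  rewrite /F -measureU//; last 2 first.
  - exact: measurable_slab.
  - apply/seteqP; split => // u [] /=; rewrite /slab/= in_itv/= => ut /(ball_coord j) /andP[? ?].
    by move: ut; rewrite ltNge (_ : t <= u ord0 j)//; lra.
  apply: le_measure; rewrite ?inE.
  - by apply: measurableU => //; exact: measurable_slab.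
  - exact: measurable_slab.
  - move=> u [/=|/(ball_coord j) /andP[? ?]]; rewrite /= /slab/= !in_itv/=.
      by move: r_gt0 g_gt0 => ? ? ?; lra.
    by lra.
apply: le_trans FU; rewrite -natr1 mulrDl mul1r EFinD; apply: leeD.
  by apply: IH; move: r_gt0 g_gt0 => ? ?; lra.
exact: concentrated.
Qed.

(** Every slab of width [g + 2 r] between two typical points captures a further
    mass [m], so fewer than [1/m] of them fit. *)
Lemma coord_spread_le (N : nat) (x y : 'rV[R]_d) : 1 < N%:R * m ->
  ~ Z x -> ~ Z y -> y ord0 j - x ord0 j <= N%:R * (g + 2 * r) + 2 * r.
Proof.
move=> Nm Zx Zy; rewrite leNgt; apply/negP => h.
have /(mass_below_ge Zx Zy) : x ord0 j + r + N%:R * (g + 2 * r) <= y ord0 j - r.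
  by lra.
apply/negP; rewrite -ltNge; apply: (@le_lt_trans _ _ 1%E); last by rewrite lte_fin.
by apply: probability_le1; exact: measurable_slab.
Qed.

End spread.

(** * A space-filling curve *)

Section digit_wave.
Context {R : realType}.

Let c : R := cos (pi / 7).

Let c_gt0 : 0 < c.
Proof. by apply: cos_gt0_pihalf; have := pi_gt0 R => ?; apply/andP; split; lra. Qed.

(** A continuous function of period [1] with values in [[0, 1]], equal to [0] to
    the right of the integers and to [1] to the right of the half-integers:
    [(1 + |v| - |v - 1|) / 2] clamps [v], and the slope of [v] makes the clamp
    active on intervals of length [1 / 14]. *)
Definition digit_wave (u : R) : R :=
  let v := 2^-1 - (2 * c)^-1 * cos (u * (pi *+ 2)) in (1 + `|v| - `|v - 1|) / 2.

Lemma continuous_digit_wave : continuous digit_wave.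
Proof.
move=> x; rewrite /digit_wave/=.
have cv : {for x, continuous (fun u : R => 2^-1 - (2 * c)^-1 * cos (u * (pi *+ 2)))}.
  apply: cvgB; first exact: cvg_cst.
  apply: cvgM; first exact: cvg_cst.
  apply: (@continuous_comp _ _ _ (fun u : R => u * (pi *+ 2)) cos).
    by apply: cvgM; [exact: cvg_id|exact: cvg_cst].
  exact: continuous_cos.
apply: cvgM; last exact: cvg_cst.
apply: cvgB; first apply: cvgD; first exact: cvg_cst.
- exact: cvg_norm.
- by apply: cvg_norm; apply: cvgB => //; exact: cvg_cst.
Qed.

Lemma digit_wave_ge0 u : 0 <= digit_wave u.
Proof.
rewrite /digit_wave; set v := (X in `|X|).
have : `|v - 1| <= `|v| + 1 by rewrite (le_trans (ler_normB _ _))// normr1.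
by move=> ?; rewrite divr_ge0//; lra.
Qed.

Lemma digit_wave_le1 u : digit_wave u <= 1.
Proof.
rewrite /digit_wave; set v := (X in `|X|).
have : `|v| <= `|v - 1| + 1.
  by rewrite -{1}(subrK 1 v) (le_trans (ler_normD _ _))// normr1.
by move=> ?; lra.
Qed.

(** The wave reads off the digit [a] from [n + a/2 + w] whenever the remainder
    [w] is small. *)
Lemma digit_wave_digit (n : nat) (a : bool) (w : R) : 0 <= w <= 14^-1 ->
  digit_wave (n%:R + a%:R / 2 + w) = a%:R.
Proof.
move=> /andP[w0 w1]; have pi0 := pi_gt0 R.
have cw : c <= cos (w * (pi *+ 2)).
  have wpi : w * pi <= 14^-1 * pi by rewrite ler_pM2r.
  have wpi0 : 0 <= w * pi by rewrite mulr_ge0// ltW.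
  have -> : w * (pi *+ 2) = 2 * (w * pi) by rewrite -(mulr_natr pi); ring.
  rewrite /c leNgt ltr_cos ?in_itv/= -?leNgt; first by lra.
  - by apply/andP; split; lra.
  - by apply/andP; split; lra.
have cosE : cos ((n%:R + a%:R / 2 + w) * (pi *+ 2)) = (-1) ^+ a * cos (w * (pi *+ 2)).
  rewrite (_ : (n%:R + _ + _) * _ = (w * (pi *+ 2) + pi *+ a) + pi *+ 2 *+ n); last first.
    rewrite -(mulr_natr (pi *+ 2)) -(mulr_natr pi a) -(mulr_natr pi 2).
    by field.
  rewrite (periodicn (@cosD2pi R)); case: a; last by rewrite addr0 mul1r.
  by rewrite cosDpi mulN1r.
have k0 : 0 < (2 * c)^-1 by rewrite invr_gt0 mulr_gt0.
have kc : (2 * c)^-1 * c = 2^-1 by rewrite invfM mulfVK// gt_eqF.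
have : 2^-1 <= (2 * c)^-1 * cos (w * (pi *+ 2)) by rewrite -kc ler_pM2l.
have clamp0 (v : R) : v <= 0 -> (1 + `|v| - `|v - 1|) / 2 = 0.
  by move=> v0; rewrite !ler0_norm; lra.
have clamp1 (v : R) : 1 <= v -> (1 + `|v| - `|v - 1|) / 2 = 1.
  by move=> v1; rewrite !ger0_norm; lra.
rewrite /digit_wave cosE; case: a {cosE} => h /=.
  by rewrite clamp1// expr1 mulN1r mulrN; lra.
by rewrite clamp0// expr0 mul1r; lra.
Qed.

End digit_wave.

Section digits.
Context {R : realType}.

(** The point with base-8 digits [4 a 0, 4 a 1, ..]: multiplying by [8 ^ m]
    brings the digit [a m] in front, up to an integer. *)
Fixpoint lacunary (a : nat -> bool) (l : nat) : R :=
  if l is l'.+1 then (a 0)%:R / 2 + lacunary (a \o succn) l' / 8 else 0.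

(** [4 / 7] is the value with all digits equal to [4]; after the leading digit the
    remainder is at most [4 / 7 / 8 = 1 / 14]. *)
Lemma lacunary_itv a l : 0 <= lacunary a l <= 4 / 7.
Proof.
elim: l a => [|l IH] a /=; first by apply/andP; split; lra.
have /andP[h0 h1] := IH (a \o succn).
by case: (a 0) => /=; apply/andP; split; lra.
Qed.

Lemma lacunary_shift a l m : exists N : nat,
  8 ^+ m * lacunary a (m + l) = N%:R + lacunary (fun i => a (m + i)%N) l.
Proof.
elim: m a => [|m IH] a; first by exists 0%N; rewrite expr0 mul1r add0r.
have [N hN] := IH (a \o succn).
exists (8 ^ m * (4 * a 0) + N)%N.
rewrite exprSr addSn [lacunary _ (m + l).+1]/=.
transitivity (8 ^+ m * (4 * (a 0)%:R) + 8 ^+ m * lacunary (a \o succn) (m + l)).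
  by field.
by rewrite hN natrD natrM natrX natrM addrA.
Qed.

Lemma digit_wave_lacunary a l m : (m < l)%N ->
  digit_wave (8 ^+ m * lacunary a l) = (a m)%:R.
Proof.
move=> ml; have [N] := lacunary_shift a (l - m.+1).+1 m.
rewrite addnS -addSn subnKC// => ->.
rewrite [lacunary _ _.+1]/= addn0 addrA digit_wave_digit//.
set a' := _ \o _; have /andP[? ?] := lacunary_itv a' (l - m.+1).
by apply/andP; split; lra.
Qed.

Fixpoint dyadic_rest (x : R) (n : nat) : R :=
  if n is n'.+1 then
    let r := dyadic_rest x n' in if 2^-1 ^+ n <= r then r - 2^-1 ^+ n else r
  else x.

(** Greedy binary expansion; [dyadic_rest x n] is what remains of [x] after [n]
    digits. *)
Lemma dyadic_digits (x : R) : 0 <= x <= 1 -> exists b : nat -> bool,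
  forall n, 0 <= x - \sum_(k < n) 2^-1 ^+ k.+1 * (b k)%:R <= 2^-1 ^+ n.
Proof.
move=> x01; exists (fun k => 2^-1 ^+ k.+1 <= dyadic_rest x k) => n.
have -> : x - \sum_(k < n) 2^-1 ^+ k.+1 * (2^-1 ^+ k.+1 <= dyadic_rest x k)%R%:R =
    dyadic_rest x n.
  elim: n => [|n IH]; first by rewrite big_ord0 subr0.
  rewrite big_ord_recr/= opprD addrA IH.
  by case: ifP; rewrite ?mulr1 ?mulr0 ?subr0.
elim: n => [|n /andP[IH0 IH1]]; first by rewrite expr0.
rewrite [dyadic_rest _ _]/=.
have e : (2^-1 : R) ^+ n = 2 * 2^-1 ^+ n.+1 by rewrite exprS; field.
case: ifP => [h|/negbT]; last by rewrite -ltNge => /ltW ->; rewrite IH0.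
by rewrite subr_ge0 h/=; lra.
Qed.

End digits.

Section dyadic_series.
Context {R : realType} {T : topologicalType}.
Variable h : nat -> T -> R.
Hypothesis h_ge0 : forall k t, 0 <= h k t.
Hypothesis h_le1 : forall k t, h k t <= 1.
Hypothesis ch : forall k, continuous (h k).

Definition dyadic_sum (n : nat) (t : T) : R :=
  \sum_(k < n) 2^-1 ^+ k.+1 * h k t.

Definition dyadic_series (t : T) : R := sup (range (dyadic_sum ^~ t)).

Let dyadic_sumS n t :
  dyadic_sum n.+1 t = dyadic_sum n t + 2^-1 ^+ n.+1 * h n t.
Proof. by rewrite /dyadic_sum big_ord_recr. Qed.

Let half_gt0 n : 0 < (2^-1 : R) ^+ n.
Proof. by rewrite exprn_gt0. Qed.

Let dyadic_sum_le m n t : (m <= n)%N -> dyadic_sum m t <= dyadic_sum n t.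
Proof.
move=> /subnK <-; elim: (n - m)%N => // k IH; rewrite addSn dyadic_sumS.
by rewrite (le_trans IH)// lerDl mulr_ge0// ltW.
Qed.

Let dyadic_sum_tail m k t :
  dyadic_sum (k + m) t <= dyadic_sum m t + 2^-1 ^+ m - 2^-1 ^+ (k + m).
Proof.
elim: k => [|k IH]; first by rewrite addrK.
have hh : 2^-1 ^+ (k + m).+1 * h (k + m)%N t <= 2^-1 ^+ (k + m).+1.
  by rewrite ler_piMr// ltW.
have e : (2^-1 : R) ^+ (k + m) = 2 * 2^-1 ^+ (k + m).+1 by rewrite exprS; field.
by rewrite addSn dyadic_sumS; move: IH; rewrite e; lra.
Qed.

Let dyadic_sum_ub m n t : dyadic_sum n t <= dyadic_sum m t + 2^-1 ^+ m.
Proof.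
have [nm|/ltnW/subnK <-] := leqP n m.
  by rewrite (le_trans (dyadic_sum_le t nm))// lerDl ltW.
by apply: le_trans (dyadic_sum_tail _ _ _) _; rewrite gerBl ltW.
Qed.

Lemma dyadic_series_itv n t :
  dyadic_sum n t <= dyadic_series t <= dyadic_sum n t + 2^-1 ^+ n.
Proof.
apply/andP; split.
  apply: ub_le_sup; last by exists n.
  by exists (dyadic_sum n t + 2^-1 ^+ n) => _ [m _ <-]; exact: dyadic_sum_ub.
apply: ge_sup; first by exists (dyadic_sum 0 t); exists 0%N.
by move=> _ [m _ <-]; exact: dyadic_sum_ub.
Qed.

Lemma half_pow_lt (e : R) : 0 < e -> exists n, (2^-1 : R) ^+ n < e.
Proof.
move=> e0; have /cvgrPdist_lt/(_ e e0)[n _ hn] : (2^-1 : R) ^+ n @[n --> \oo] --> (0 : R).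
  by apply: cvg_expr; rewrite ger0_norm//; lra.
exists n; have := hn n (leqnn n).
by rewrite /= sub0r normrN ger0_norm// ltW.
Qed.

Lemma continuous_dyadic_series : continuous dyadic_series.
Proof.
move=> x; apply/cvgrPdist_lt => e e0.
have [n hn] := half_pow_lt (divr_gt0 e0 (ltr0n R 2)).
have cS : {for x, continuous (dyadic_sum n)}.
  elim: {hn} n => [|n IH].
    rewrite (_ : dyadic_sum 0 = cst 0); first exact: cvg_cst.
    by apply/funext => t; rewrite /dyadic_sum big_ord0.
  rewrite (_ : dyadic_sum n.+1 = fun t => dyadic_sum n t + 2^-1 ^+ n.+1 * h n t).
    by apply: cvgD => //; apply: cvgM; [exact: cvg_cst|exact: ch].
  exact/funext.
have e2 : 0 < e / 2 by rewrite divr_gt0.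
move/cvgrPdist_lt : cS => /(_ _ e2); apply: filterS => t.
have /andP[] := dyadic_series_itv n x; have /andP[] := dyadic_series_itv n t.
by rewrite !ltr_norml => ? ? ? ? /andP[? ?]; apply/andP; split; lra.
Qed.

End dyadic_series.

Section curve.
Context {R : realType} (d : nat).

(** A continuous space-filling curve in the manner of Schoenberg: coordinate [j]
    decodes the digits of [t] whose positions are congruent to [j] modulo [d]. *)
Definition peano_curve (t : R) : 'rV[R]_d :=
  \row_j dyadic_series (fun k (t : R) => digit_wave (8 ^+ (k * d + j) * t)) t.

Lemma continuous_peano_coord (j : 'I_d) : continuous (fun t => peano_curve t ord0 j).
Proof.
rewrite (_ : (fun t => _) =
  dyadic_series (fun k (t : R) => digit_wave (8 ^+ (k * d + j) * t))).
  apply: continuous_dyadic_series => [k t|k t|k t].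
  - exact: digit_wave_ge0.
  - exact: digit_wave_le1.
  - apply: (@continuous_comp _ _ _ (fun t : R => 8 ^+ (k * d + j) * t)).
      by apply: cvgM; [exact: cvg_cst|exact: cvg_id].
    exact: continuous_digit_wave.
by apply/funext => t; rewrite mxE.
Qed.

Lemma continuous_rV (T : topologicalType) (f : T -> 'rV[R]_d) :
  (forall j, continuous (fun t => f t ord0 j)) -> continuous f.
Proof.
move=> cf t; apply/cvg_ballP => e e0.
have : \forall s \near t, forall j : 'I_d, ball (f t ord0 j) e (f s ord0 j).
  apply: filter_forall => j.
  by have /cvg_ballP := cf j t; apply.
apply: filterS => s hs; split => // i j; rewrite ord1; exact: hs.
Qed.

Lemma peano_curve_coord01 t j : 0 <= peano_curve t ord0 j <= 1.
Proof.
rewrite mxE; set h := (fun k (t : R) => digit_wave _).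
have := @dyadic_series_itv R R h (fun _ _ => digit_wave_ge0 _)
  (fun _ _ => digit_wave_le1 _) 0 t.
by rewrite /dyadic_sum big_ord0 expr0 add0r.
Qed.

Lemma continuous_peano_curve : continuous peano_curve.
Proof. exact/continuous_rV/continuous_peano_coord. Qed.

(** Choose the digits of [t] by interleaving the binary digits of the
    coordinates of [x]. Finitely many of them suffice here, and the exact
    equality in [peano_curve_surj] follows since the image of a segment is
    closed. *)
Lemma peano_curve_approx (x : 'rV[R]_d) (n : nat) :
  (forall j, 0 <= x ord0 j <= 1) -> exists2 t : R, 0 <= t <= 1 &
    forall j, `|x ord0 j - peano_curve t ord0 j| <= 2^-1 ^+ n.
Proof.
move=> x01; have [b hb] := choice (fun j => dyadic_digits (x01 j)).
case: (posnP d) => [d0|d_gt0].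
  by exists 0; rewrite ?lexx ?ler01// => j; have := ltn_ord j; rewrite {2}d0.
(* position [k * d + j] holds the [k]-th digit of coordinate [j] *)
pose a (m : nat) := b (Ordinal (ltn_pmod m d_gt0)) (m %/ d)%N.
exists (lacunary a (n * d)%N).
  by have /andP[-> ?] := @lacunary_itv R a (n * d); lra.
move=> j; rewrite mxE.
set h := (fun k (t : R) => digit_wave _).
have hS : dyadic_sum h n (lacunary a (n * d)) = \sum_(k < n) 2^-1 ^+ k.+1 * (b j k)%:R.
  apply: eq_bigr => k _; rewrite /h digit_wave_lacunary; last first.
    rewrite (@leq_trans (k * d + d))//; first by rewrite ltn_add2l.
    by rewrite addnC -mulSn leq_mul2r ltn_ord orbT.
  rewrite /a divnMDl// divn_small// addn0; congr (_ * (b _ _)%:R).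
  by apply: val_inj; rewrite /= modnMDl modn_small.
have /andP[] := @dyadic_series_itv R R h (fun _ _ => digit_wave_ge0 _)
  (fun _ _ => digit_wave_le1 _) n (lacunary a (n * d)).
have /andP[] := hb j n; rewrite hS ler_norml => ? ? ? ?.
by apply/andP; split; lra.
Qed.

Lemma peano_curve_surj (x : 'rV[R]_d) :
  (forall j, 0 <= x ord0 j <= 1) -> exists2 t : R, 0 <= t <= 1 & peano_curve t = x.
Proof.
move=> x01.
have cI : compact (peano_curve @` `[0, 1]).
  apply: continuous_compact; last exact: segment_compact.
  exact/continuous_subspaceT/continuous_peano_curve.
have clI : closed (peano_curve @` `[0, 1]).
  by apply: compact_closed cI; exact: norm_hausdorff.
have : (peano_curve @` `[0, 1]) x.
  apply: clI => B /nbhs_ballP[e /= e0 xB].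
  have [n hn] := half_pow_lt e0.
  have [t t01 ht] := peano_curve_approx n x01.
  exists (peano_curve t); split; first by exists t => //=; rewrite in_itv.
  apply: xB; split => // i j; rewrite ord1.
  exact: le_lt_trans (ht j) hn.
by move=> [t /=]; rewrite in_itv/= => t01 <-; exists t.
Qed.

End curve.

(** * Borel sections of curves and quantile functions *)

Lemma closure_inf (R : realType) (A : set R) :
  A !=set0 -> has_lbound A -> closure A (inf A).
Proof.
move=> A0 lbA B /nbhs_ballP[e /= e0 AB].
have [t At ht] := inf_adherent e0 (conj A0 lbA).
exists t; split => //; apply: AB; rewrite /ball/= ltr_distlC ht andbT.
by rewrite (@lt_le_trans _ _ (inf A))// ?ge_inf// ltrBlDr ltrDl.
Qed.

Section measurable_selection.
Context {R : realType} {d : nat}.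
Variable gamma : R -> 'rV[R]_d.
Hypothesis cgamma : continuous gamma.

Let parameters (x : 'rV[R]_d) : set R := [set t | 0 <= t <= 1 /\ gamma t = x].

Let lbP x : has_lbound (parameters x).
Proof. by exists 0 => t [/andP[]]. Qed.

(** The smallest parameter at which a curve visits a point: among the
    visited points its sublevel sets are compact images of segments, which makes
    it Borel. *)
Definition first_visit (x : 'rV[R]_d) : R := inf (parameters x).

Let compact_image a b : compact (gamma @` `[a, b]).
Proof.
apply: continuous_compact; last exact: segment_compact.
exact: continuous_subspaceT.
Qed.

Let measurable_image a b : measurable (gamma @` `[a, b]).
Proof.
have cl : closed (gamma @` `[a, b]).
  by apply: (compact_closed _ (@compact_image a b)); exact: norm_hausdorff.
exact: closed_measurable_rV.
Qed.

Lemma first_visitP x : (exists2 t, 0 <= t <= 1 & gamma t = x) ->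
  0 <= first_visit x <= 1 /\ gamma (first_visit x) = x.
Proof.
move=> [t0 t01 gt0]; suff : parameters x (first_visit x) by [].
have ne : parameters x !=set0 by exists t0.
have cl : closed (parameters x).
  rewrite (_ : parameters x = `[0, 1]%classic `&` gamma @^-1` [set x]).
    apply: closedI; first exact: itv_closed.
    apply: closed_comp => [t _|]; first exact: cgamma.
    by apply: accessible_closed_set1; apply: hausdorff_accessible; exact: norm_hausdorff.
  by apply/seteqP; split => t /=; rewrite in_itv.
apply: cl; apply: closure_inf => //; exact: lbP.
Qed.

Lemma measurable_first_visit : measurable_fun setT first_visit.
Proof.
apply: (measurability _ (RGenOInfty.measurableE R)).
move=> _ [_ [a ->] <-]; rewrite setTI.
rewrite (_ : _ @^-1` _ = ~` [set x | first_visit x <= a]); last first.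
  by apply/seteqP; split => x /=; rewrite in_itv/= andbT ltNge => /negP.
apply: measurableC.
have empty_visit x : ~ (gamma @` `[0, 1]) x -> first_visit x = 0.
  move=> h; rewrite /first_visit (_ : parameters x = set0) ?inf0//.
  by apply/seteqP; split => // t [t01 gt]; apply: h; exists t => //=; rewrite in_itv.
have visit x : (gamma @` `[0, 1]) x -> 0 <= first_visit x <= 1 /\ gamma (first_visit x) = x.
  by move=> [t /=]; rewrite in_itv/= => t01 <-; apply: first_visitP; exists t.
have [a0|a0] := ltP a 0.
  rewrite (_ : [set x | _] = set0)//; apply/seteqP; split => // x /=.
  have [/visit[/andP[s0 _] _]|/empty_visit ->] := pselect ((gamma @` `[0, 1]) x).
    by move=> /(le_trans s0); rewrite leNgt a0.
  by rewrite leNgt a0.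
rewrite (_ : [set x | _] =
    ((gamma @` `[0, a]) `&` (gamma @` `[0, 1])) `|` ~` (gamma @` `[0, 1])).
  apply: measurableU; last exact: measurableC.
  exact: measurableI.
apply/seteqP; split => x /=.
  have [gx|gx _] := pselect ((gamma @` `[0, 1]) x); last by right.
  have [/andP[s0 s1] gs] := visit _ gx => sa; left; split => //.
  by exists (first_visit x) => //=; rewrite in_itv/= s0.
move=> [[[t /=]]|]; last by move=> /empty_visit ->.
rewrite in_itv/= => /andP[t0 ta] <- [u /=]; rewrite in_itv/= => u01 ut.
have [ta1|ta1] := leP t 1.
  by apply: le_trans ta; apply: ge_inf => //; split => //; rewrite t0.
apply: le_trans (le_trans (ltW ta1) ta).
by have [] := visit (gamma t) (ex_intro2 _ _ u (_ : _) ut); rewrite /= ?in_itv//= => /andP[].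
Qed.

End measurable_selection.

Section quantile.
Context {R : realType}.

Lemma uniform_exists : exists U : probability (measurableTypeR R) R,
  forall A, U A = lebesgue_measure (A `&` `[0%R, 1%R]).
Proof.
have mI : measurable (`[0%R, 1%R]%classic : set (measurableTypeR R)).
  exact: measurable_itv.
have mT : mrestr (@lebesgue_measure R) mI setT = (1 : R)%:E.
  by rewrite /mrestr setTI lebesgue_measure_itv/= lte01 oppr0 adde0.
have [U UE] := normalize_exists (dirac (0 : measurableTypeR R)) ltr01 mT.
by exists U => A; have := UE A; rewrite mul1e => <-.
Qed.

Lemma probability_eq_ray (P Q : probability (measurableTypeR R) R) :
  (forall r, P [set x | x <= r] = Q [set x | x <= r]) ->
  forall A, measurable A -> P A = Q A.
Proof.
move=> PQ A mA.
have rayC r : ~` [set` `]r, +oo[] = [set x : measurableTypeR R | x <= r].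
  by apply/seteqP; split => x /=; rewrite in_itv/= andbT leNgt => /negP.
refine (@measure_unique _ R (measurableTypeR R) (@RGenOInfty.G R) (fun n : nat => [set` `](- n%:R : R), +oo[]) _ _ _ _ P Q _ _ A mA).
- exact: RGenOInfty.measurableE.
- move=> _ _ [a ->] [b ->]; exists (Num.max a b).
  by apply/seteqP; split => x /=; rewrite !in_itv/= !andbT gt_max => /andP.
- by move=> n; exists (- n%:R).
- apply/seteqP; split => // x _; exists (Num.truncn `|x|).+1 => //=.
  rewrite in_itv/= andbT ltrNl (le_lt_trans _ (truncnS_gt _))// -normrN.
  exact: ler_norm.
- move=> _ [r ->].
  have mr : measurable ([set` `]r, +oo[] : set (measurableTypeR R)) by exact: measurable_itv.
  have oneB_inj (p q : \bar R) : p \is a fin_num -> q \is a fin_num ->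
      (1 - p = 1 - q)%E -> p = q.
    by case: p q => [p| |] [q| |]// _ _ [/addrI/oppr_inj ->].
  apply: oneB_inj; [exact: fin_num_measure|exact: fin_num_measure|].
  by have := PQ r; rewrite -rayC !probability_setC.
- by move=> n; apply: le_lt_trans (ltry 1); apply: probability_le1; exact: measurable_itv.
Qed.

(** Inverse transform sampling on the unit interval. *)
Lemma quantile_exists (U nu : probability (measurableTypeR R) R) :
  (forall A, U A = lebesgue_measure (A `&` `[0%R, 1%R])) ->
  nu [set x | 0 <= x <= 1] = 1%E ->
  exists Q : R -> R, [/\ {homo Q : x y / (x <= y)%R}, (forall t, 0 <= Q t <= 1) &
    forall A : set (measurableTypeR R), measurable A -> nu A = U (Q @^-1` A)].
Proof.
move=> UE nu01.
pose ray x : set (measurableTypeR R) := [set y | y <= x].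
have mray x : measurable (ray x).
  exact: (measurable_itv `]-oo, x]).
pose F x := fine (nu (ray x)).
have FE x : nu (ray x) = (F x)%:E by rewrite fineK// fin_num_measure.
have F_homo x y : x <= y -> F x <= F y.
  move=> xy; rewrite -lee_fin -!FE; apply: le_measure; rewrite ?inE//.
  by move=> z /= /le_trans; exact.
have F_ge0 x : 0 <= F x by rewrite -lee_fin -FE.
have F_le1 x : F x <= 1 by rewrite -lee_fin -FE probability_le1.
have F1 : F 1 = 1.
  apply/eqP; rewrite eq_le F_le1/= -lee_fin -FE -nu01; apply: le_measure; rewrite ?inE//.
  - rewrite (_ : mkset _ = [set` `[0, 1]]); first exact: measurable_itv.
    by apply/seteqP; split => y /=; rewrite in_itv.
  - by move=> x /= /andP[].
have F0 x : x < 0 -> F x = 0.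
  move=> x0; apply/eqP; rewrite eq_le F_ge0 andbT -lee_fin -FE.
  have m01 : measurable ([set x | 0 <= x <= 1] : set (measurableTypeR R)).
    rewrite (_ : mkset _ = [set` `[0, 1]]); first exact: measurable_itv.
    by apply/seteqP; split => y /=; rewrite in_itv.
  apply: (@le_trans _ _ (nu (~` [set x | 0 <= x <= 1]))).
    apply: le_measure; rewrite ?inE//; first exact: measurableC.
    move=> y /= yx; apply/negP; rewrite negb_and -ltNge.
    by rewrite (le_lt_trans yx).
  by rewrite probability_setC// nu01 subee.
have F_rc x e : 0 < e -> exists2 y, x < y & F y < F x + e.
  move=> e0.
  have capE : \bigcap_n ray (x + n.+1%:R^-1) = ray x.
    apply/seteqP; split => y /= h; last first.
      by move=> n _; apply: (le_trans h); rewrite lerDl.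
    apply/ler_addgt0Pr => e' e'0.
    have [n hn] : exists n : nat, n.+1%:R^-1 < e'.
      by have /filter_ex[n ?] := near_infty_natSinv_lt (PosNum e'0); exists n.
    by apply: le_trans (h n I) _; rewrite lerD2l ltW.
  have cv : nu (ray (x + n.+1%:R^-1)) @[n --> \oo] --> nu (ray x).
    rewrite -capE; apply: nonincreasing_cvg_mu => //.
    - by rewrite (le_lt_trans (probability_le1 _ _))// ltry.
    - by rewrite capE.
    - move=> m n mn; apply/subsetPset => y /= h; apply: (le_trans h).
      by rewrite lerD2l lef_pV2 ?posrE// ler_nat.
  rewrite FE in cv.
  have {cv}/cvgrPdist_lt/(_ _ e0)/filter_ex[n hn] :
      F (x + n.+1%:R^-1) @[n --> \oo] --> F x.
    by apply: fine_cvg.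
  exists (x + n.+1%:R^-1); first by rewrite ltrDl invr_gt0.
  by move: hn; rewrite ltr_distlC => /andP[].
(* the alternative [x = 1] makes [S t] nonempty, so that [Q] is monotone on R *)
pose S t : set R := [set x | 0 <= x <= 1 /\ (t <= F x \/ x = 1)].
have S1 t : S t 1 by split; [rewrite ler01 lexx|right].
have lbS t : has_lbound (S t) by exists 0 => x [/andP[]].
pose Q t := inf (S t).
have Q0 t : 0 <= Q t by apply: lb_le_inf; [exists 1|move=> x [/andP[]]].
have Q1 t : Q t <= 1 by apply: ge_inf.
have Q_homo : {homo Q : x y / x <= y}.
  move=> s t st; apply: lb_le_inf; first by exists 1.
  move=> x [x01 h]; apply: ge_inf => //; split => //.
  by case: h => [/(le_trans st)|]; [left|right].
exists Q; split => // [t|A mA]; first by rewrite Q0 Q1.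
have mQ : measurable_fun setT (Q : measurableTypeR R -> measurableTypeR R).
  exact: nondecreasing_measurable.
have [nu' nu'E] := pushforward_exists U mQ.
rewrite -nu'E; apply: probability_eq_ray => // x.
rewrite nu'E UE -/(ray x) FE.
have [x0|x0] := ltP x 0.
  rewrite F0// (_ : _ `&` _ = set0) ?measure0//.
  apply/seteqP; split => // t [/= Qx _].
  by have := le_lt_trans Qx x0; rewrite ltNge Q0.
rewrite (_ : _ `&` _ = [set` `[0, F x]]).
  by rewrite lebesgue_measure_itv/= lte_fin; case: ltgtP (F_ge0 x) => // [_|<-] _;
    rewrite ?oppr0 ?adde0.
apply/seteqP; split => t /=; rewrite !in_itv/=.
  move=> [Qx /andP[-> t1]]/=.
  rewrite leNgt; apply/negP => Ft.
  have [y xy Fy] : exists2 y, x < y & F y < F x + (t - F x).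
    by apply: F_rc; rewrite subr_gt0.
  rewrite addrC subrK in Fy.
  have [z [z01 zt] zy] : exists2 z, S t z & z < Q t + (y - x).
    by apply: inf_adherent; [rewrite subr_gt0|split => //; exists 1].
  have {}zt : t <= F z by case: zt => // ->; rewrite F1.
  have : F z <= F y.
    by apply: F_homo; apply: le_trans (ltW zy) _; rewrite -lerBrDr subKr.
  by move=> /(le_trans zt); rewrite leNgt Fy.
move=> /andP[t0 tF]; rewrite t0/= (le_trans tF)//; split => //.
have [x1|/ltW x1] := leP x 1; last exact: le_trans (Q1 t) x1.
by apply: ge_inf => //; split; [rewrite x0|left].
Qed.

End quantile.

(** * Helly's selection theorem *)

Section helly_selection.
Context {R : realType}.
Variable g : nat -> R -> R.
Hypothesis g_homo : forall n, {homo g n : x y / x <= y}.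
Hypothesis g01 : forall n t, 0 <= g n t <= 1.

(** An ultrafilter on the indices gives limits at all rationals at once; an
    index [iota k] that is [1/(k+1)]-good at the first [k] rationals exists
    because finitely many large sets meet. *)
Lemma rational_limits : exists (iota : nat -> nat) (l : rat -> R),
  (forall k, (k <= iota k)%N) /\ forall q, g (iota k) (ratr q) @[k --> \oo] --> l q.
Proof.
have [U [UU subU]] := ultraFilterLemma (T := nat) (F := \oo) _.
have PU : ProperFilter U by exact: ultra_proper.
have limq (q : rat) : exists l : R, forall e : R, 0 < e ->
    U [set n | `|l - g n (ratr q)| < e].
  have co : compact `[(0 : R), 1]%classic by exact: segment_compact.
  have [|l [_ cl]] := co (g ^~ (ratr q) @ U) _.
    by apply: (@filterE _ U) => n /=; have := g01 n (ratr q); rewrite /= in_itv.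
  exists l => e e0; have [//|UC] := in_ultra_setVsetC [set n | `|l - g n (ratr q)| < e] UU.
  exfalso.
  have [y [hy hl]] := cl [set y | ~ `|l - y| < e] (ball l e) UC (nbhsx_ballx _ _ e0).
  exact: hy.
have [l hl] := choice limq.
(* the first [k] rationals are those with a code below [k] *)
have pick k : exists n, (k <= n)%N /\ forall i : 'I_k, forall q, unpickle i = Some q ->
    `|l q - g n (ratr q)| < k.+1%:R^-1.
  have Uk : U [set n | (k <= n)%N] by apply: subU; exists k.
  have Uq : U [set n | forall i : 'I_k, forall q, unpickle i = Some q ->
      `|l q - g n (ratr q)| < k.+1%:R^-1].
    apply: filter_forall => i; case: (unpickle i) => [q|]; last by apply: filterE.
    have : U [set n | `|l q - g n (ratr q)| < k.+1%:R^-1].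
      by apply: hl; rewrite invr_gt0.
    by apply: filterS => n h q' [<-].
  by have [n [? ?]] := filter_ex (filterI Uk Uq); exists n.
have [iota hiota] := choice pick.
exists iota, l; split => [k|q]; first by have [] := hiota k.
apply/cvgrPdist_lt => e e0.
have := near_infty_natSinv_lt (PosNum e0); apply: filter_app.
exists (pickle q).+1 => // k /= qk ke; apply: lt_trans ke.
by have [_ /(_ (Ordinal qk) q)] := hiota k; apply; rewrite /= pickleK.
Qed.

Lemma rat_between (x y : R) : x < y -> exists q : rat, x < (ratr q : R) < y.
Proof. by move=> /rat_in_itvoo[q]; rewrite in_itv/= => h; exists q. Qed.

(** Monotone functions with values in a segment: limits along the rationals,
    obtained from an ultrafilter, pin down the limit off the countable set of
    jumps. *)
Lemma helly_selection : exists (iota : nat -> nat) (G : R -> R) (D : set R),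
  [/\ forall k, (k <= iota k)%N, {homo G : x y / (x <= y)%R}, countable D &
      forall t, ~ D t -> g (iota k) t @[k --> \oo] --> G t].
Proof.
have [iota [l [hiota hl]]] := rational_limits.
have l0 q : 0 <= l q.
  by apply: cvgr_to_ge (hl q) _; apply: nearW => k; have /andP[] := g01 (iota k) (ratr q).
have l1 q : l q <= 1.
  by apply: cvgr_to_le (hl q) _; apply: nearW => k; have /andP[] := g01 (iota k) (ratr q).
pose lo (t : R) := [set l q | q in [set q : rat | (ratr q : R) < t]].
pose hi (t : R) := [set l q | q in [set q : rat | t < (ratr q : R)]].
have lo_ub t : has_ubound (lo t) by exists 1 => _ [q _ <-].
have hi_lb t : has_lbound (hi t) by exists 0 => _ [q _ <-].
have lo_ne t : lo t !=set0.
  have [|q /andP[_ qt]] := @rat_between (t - 1) t; first by rewrite gtrBl.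
  by exists (l q); exists q.
have hi_ne t : hi t !=set0.
  have [|q /andP[tq _]] := @rat_between t (t + 1); first by rewrite ltrDl.
  by exists (l q); exists q.
pose G t := sup (lo t).
pose H t := inf (hi t).
have HG s t : s < t -> H s <= G t.
  move=> /rat_between[q /andP[sq qt]]; apply: (@le_trans _ _ (l q)).
    by apply: ge_inf => //; exists q.
  by apply: ub_le_sup => //; exists q.
exists iota, G, [set t | G t < H t]; split => //.
- move=> s t; rewrite le_eqVlt => /orP[/eqP->//|st].
  apply: ge_sup => // _ [q /= qs <-]; apply: ub_le_sup => //; exists q => //=.
  exact: lt_trans st.
- have pickq t : exists q : rat, G t < H t -> G t < (ratr q : R) < H t.
    have [/rat_between[q h]|_] := boolP (G t < H t); first by exists q.
    by exists 0.
  have [c hc] := choice pickq.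
  apply/countable_injP; exists (pickle \o c) => s t; rewrite !inE/= => sD tD.
  move=> /(pcan_inj pickleK) cst.
  have /andP[c1 c2] := hc _ sD; have /andP[c3 c4] := hc _ tD.
  have [st|ts|//] := ltgtP s t.
    have := lt_trans (lt_le_trans c2 (HG _ _ st)) c3.
    by move: cst => /= ->; rewrite ltxx.
  have := lt_trans (lt_le_trans c4 (HG _ _ ts)) c1.
  by move: cst => /= ->; rewrite ltxx.
- move=> t /negP; rewrite -leNgt => HGt; apply/cvgrPdist_lt => e e0.
  have [_ [q qt <-] hq] := sup_adherent e0 (conj (lo_ne t) (lo_ub t)).
  have [_ [q' tq' <-] hq'] := inf_adherent e0 (conj (hi_ne t) (hi_lb t)).
  have e1 : 0 < l q - (G t - e) by rewrite subr_gt0.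
  have e2 : 0 < H t + e - l q' by rewrite subr_gt0.
  move/cvgrPdist_lt : (hl q) => /(_ _ e1) A.
  move/cvgrPdist_lt : (hl q') => /(_ _ e2); apply: filterS2 A => k.
  rewrite !ltr_norml => /andP[? ?] /andP[? ?].
  have := g_homo (iota k) (ltW qt); have := g_homo (iota k) (ltW tq').
  by move=> ? ?; apply/andP; split; lra.
Qed.

End helly_selection.

(** * Lower semicontinuity of the energy *)

Section lower_semicontinuity.
Context {R : realType}.
Local Open Scope ereal_scope.

Lemma lee_of_lt_EFin (x y : \bar R) : (forall r : R, r%:E < x -> r%:E <= y) -> x <= y.
Proof.
case: x => [r| |] h; last by rewrite leNye.
- by apply/lee_subgt0Pr => e e0; rewrite -EFinB h// lte_fin ltrBlDr ltrDl.
- have /eqyP -> // : forall A : R, (0 < A)%R -> A%:E <= y.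
  by move=> A _; exact: h (ltry A).
Qed.

Lemma limn_einf_ge (u : (\bar R)^nat) (a : \bar R) :
  (\forall n \near \oo, a <= u n) -> a <= limn_einf u.
Proof.
move=> [N _ hN]; rewrite limn_einf_lim.
rewrite (cvg_lim _ (@cvg_einfs_sup _ u))//.
apply: (@le_trans _ _ (einfs u N)); last by apply: ereal_sup_ubound; exists N.
by apply: le_ereal_inf_tmp => _ [n /= Nn <-]; exact: hN.
Qed.

Lemma limn_einf_le (u : (\bar R)^nat) (a : \bar R) :
  (\forall n \near \oo, u n <= a) -> limn_einf u <= a.
Proof.
move=> [N _ hN]; rewrite limn_einf_lim.
rewrite (cvg_lim _ (@cvg_einfs_sup _ u))//.
apply: ge_ereal_sup => _ [n _ <-].
apply: (@le_trans _ _ (u (maxn n N))); last by apply: hN; exact: leq_maxr.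
by apply: ereal_inf_lbound; exists (maxn n N) => //=; exact: leq_maxl.
Qed.

Lemma measurable_fun_limn_einf dd (T : measurableType dd) (f : (T -> \bar R)^nat) :
  (forall n, measurable_fun setT (f n)) ->
  measurable_fun setT (fun x => limn_einf (f ^~ x)).
Proof.
move=> mf; rewrite (_ : (fun x => _) = (fun x => - limn_esup (fun n => - f n x))).
  apply: measurableT_comp => //.
  apply: (@measurable_fun_limn_esup _ _ _ _ (fun n x => - f n x)) => n.
  exact: measurableT_comp.
apply/funext => x; rewrite -limn_einfN.
by rewrite (_ : _ \o _ = f ^~ x)//; apply/funext => n /=; rewrite oppeK.
Qed.

Lemma lower_semicontinuous_limn_einf (T : topologicalType) (f : T -> \bar R)
    (x_ : T^nat) (x : T) : lower_semicontinuous f -> x_ @ \oo --> x ->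
  f x <= limn_einf (f \o x_).
Proof.
move=> lf xx; apply: lee_of_lt_EFin => r /lf[A Ax hA].
have h : \forall n \near \oo, A (x_ n) by exact: xx.
by apply: limn_einf_ge; apply: filterS h => n /hA /ltW.
Qed.

End lower_semicontinuity.

Section fatou_energy.
Context {R : realType} {d : nat}.
Variable V : 'rV[R]_d -> \bar R.
Hypothesis mV : measurable_fun setT V.
Hypothesis V_ge0 : forall x, (0 <= V x)%E.
Hypothesis V_lsc : lower_semicontinuous V.
Local Notation k := (difference_kernel V).
Local Notation mk := (measurable_difference_kernel mV).

Lemma measurable_kernel_comp dS (S : measurableType dS) (X : S -> 'rV[R]_d) :
  measurable_fun setT X -> measurable_fun setT (fun z : S * S => k (X z.1, X z.2)).
Proof.
move=> mX; apply: (measurableT_comp mk); apply: measurable_fun_pair.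
- exact: (measurableT_comp mX measurable_fst).
- exact: (measurableT_comp mX measurable_snd).
Qed.

Lemma fatou_double_integral dS (S : measurableType dS) (P : probability S R)
    (X_ : nat -> S -> 'rV[R]_d) (X : S -> 'rV[R]_d) :
  (forall n, measurable_fun setT (X_ n)) -> measurable_fun setT X ->
  {ae P, forall s, X_ n s @[n --> \oo] --> X s} ->
  (\int[P]_s \int[P]_t k (X s, X t) <=
   limn_einf (fun n => \int[P]_s \int[P]_t k (X_ n s, X_ n t)))%E.
Proof.
move=> mX_ mX XX.
have mf n := measurable_kernel_comp (mX_ n).
have mfX := measurable_kernel_comp mX.
have k0 z : (0 <= k z)%E by exact: V_ge0.
have mf2 n : measurable_fun setT (fun s => \int[P]_t k (X_ n s, X_ n t))%E.
  exact: (measurable_fun_fubini_tonelli_F _ (mf n) (fun z => k0 _)).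
have einf0 (u : (\bar R)^nat) : (forall n, 0 <= u n)%E -> (0 <= limn_einf u)%E.
  by move=> u0; apply: limn_einf_ge; exact: nearW.
apply: (@le_trans _ _ (\int[P]_s limn_einf (fun n => \int[P]_t k (X_ n s, X_ n t)))%E);
  last first.
  by apply: fatou => // n s _; exact: integral_ge0.
apply: ae_ge0_le_integral => //.
- by move=> s _; exact: integral_ge0.
- exact: (measurable_fun_fubini_tonelli_F _ mfX (fun z => k0 _)).
- by move=> s _; apply: einf0 => n; exact: integral_ge0.
- exact: measurable_fun_limn_einf.
have sec n s : measurable_fun setT (fun t => k (X_ n s, X_ n t)).
  exact: (measurableT_comp (mf n) (measurable_pair1 s)).
move: (XX); apply: filterS => s Xs _.
apply: (@le_trans _ _ (\int[P]_t limn_einf (fun n => k (X_ n s, X_ n t)))%E); last first.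
  exact: fatou.
apply: ae_ge0_le_integral => //.
- exact: (measurableT_comp mfX (measurable_pair1 s)).
- by move=> t _; exact: einf0.
- exact: measurable_fun_limn_einf.
move: XX; apply: filterS => t Xt _.
apply: (lower_semicontinuous_limn_einf V_lsc (x_ := fun n => X_ n s - X_ n t)).
exact: cvgB.
Qed.

End fatou_energy.

(** * Minimisers on a box *)

Section box.
Context {R : realType} {d : nat}.

(** Extended radii let [box +oo] be the whole space, so that global minimisers
    and minimisers on a cube are handled together. *)
Definition box (n : \bar R) : set 'rV[R]_d := [set x | (`|x|%:E <= n)%E].

Lemma measurable_box n : measurable (box n).
Proof.
apply: closed_measurable_rV.
case: n => [r| |].
- rewrite (_ : box _ = (fun x => `|x|) @^-1` [set y | y <= r]); last first.
    by apply/seteqP; split => x; rewrite /box/= lee_fin.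
  by apply: closed_comp; [move=> x _; exact: norm_continuous|exact: closed_le].
- have -> : box +oo = setT by apply/seteqP; split => x // _; exact: leey.
  exact: closedT.
- have -> : box -oo = set0 by apply/seteqP; split => x.
  exact: closed0.
Qed.

Definition box_curve (r : R) (t : R) : 'rV[R]_d :=
  \row_j (r * (2 * peano_curve d t ord0 j - 1)).

Lemma continuous_box_curve_coord r j : continuous (fun t => box_curve r t ord0 j).
Proof.
rewrite (_ : (fun t => _) = fun t : R => r * (2 * peano_curve d t ord0 j - 1)).
  move=> t; apply: cvgM; first exact: cvg_cst.
  apply: cvgB; last exact: cvg_cst.
  by apply: cvgM; [exact: cvg_cst|exact: continuous_peano_coord].
by apply/funext => t; rewrite mxE.
Qed.

Lemma box_curve_in_box r t : 0 <= r -> box r%:E (box_curve r t).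
Proof.
move=> r0; rewrite /box/= lee_fin; apply: rV_norm_le => // j.
have := peano_curve_coord01 t j; rewrite [box_curve _ _ _ _]mxE normrM ger0_norm// => h.
by rewrite ler_piMr// ler_norml; case/andP: h => ? ?; apply/andP; split; lra.
Qed.

Lemma box_curve_surj r (x : 'rV[R]_d) : 0 < r -> box r%:E x ->
  exists2 t, 0 <= t <= 1 & box_curve r t = x.
Proof.
move=> r0; rewrite /box/= lee_fin => xr.
have [|t t01 tx] := @peano_curve_surj R d (\row_j ((x ord0 j / r + 1) / 2)).
  move=> j; rewrite mxE.
  have : `|x ord0 j / r| <= 1.
    rewrite normrM (ger0_norm (_ : 0 <= r^-1)) ?invr_ge0 ?(ltW r0)//.
    by rewrite ler_pdivrMr// mul1r (le_trans (coord_le_norm x j)).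
  by rewrite ler_norml => /andP[? ?]; apply/andP; split; lra.
exists t => //; apply/rowP => j; rewrite mxE tx mxE.
by field; rewrite gt_eqF.
Qed.

End box.

Section box_compactness.
Context {R : realType} {d : nat}.
Variable V : 'rV[R]_d -> \bar R.
Hypothesis mV : measurable_fun setT V.
Hypothesis V_ge0 : forall x, (0 <= V x)%E.
Hypothesis V_lsc : lower_semicontinuous V.
Local Notation J rho := (interaction (difference_kernel V) rho rho).

(** With [s] a Borel section of the curve [gamma] and [Q k] the quantile function
    of the image of [rho_ k] under [s], the variable [gamma (Q k)] on the unit
    interval has law [rho_ k]. Convergence of [Q k] off a countable set passes
    to these variables, and the law of their limit is the required measure. *)
Lemma box_compactness (r : R) (rho_ : nat -> probability 'rV[R]_d R) : 0 < r ->
  (forall k, rho_ k (~` box r%:E) = 0%E) ->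
  exists (iota : nat -> nat) (rho : probability 'rV[R]_d R),
    [/\ forall k, (k <= iota k)%N, rho (~` box r%:E) = 0%E &
        (J rho <= limn_einf (fun k => J (rho_ (iota k))))%E].
Proof.
move=> r0 rho_box.
pose gamma : measurableTypeR R -> 'rV[R]_d := box_curve r.
have cgamma : continuous (box_curve r : R -> 'rV[R]_d).
  exact/continuous_rV/continuous_box_curve_coord.
have mgamma : measurable_fun setT gamma.
  apply: measurable_fun_rV => j; apply: continuous_measurable_fun.
  exact: continuous_box_curve_coord.
pose s : 'rV[R]_d -> measurableTypeR R := first_visit (box_curve r).
have ms : measurable_fun setT s by exact: measurable_first_visit.
have sP x : box r%:E x -> 0 <= s x <= 1 /\ gamma (s x) = x.
  by move=> /(box_curve_surj r0); exact: first_visitP.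
have [U UE] := @uniform_exists R.
have quant k : exists Q : R -> R,
   [/\ {homo Q : x y / (x <= y)%R}, (forall t, 0 <= Q t <= 1) &
    forall A, measurable A -> rho_ k A = U ((gamma \o Q) @^-1` A)].
  have [nu nuE] := pushforward_exists (rho_ k) ms.
  have mbox : measurable (box r%:E : set 'rV[R]_d) by exact: measurable_box.
  have nu01 : nu [set x | 0 <= x <= 1] = 1%E.
    apply/eqP; rewrite eq_le probability_le1/=; last first.
      exact: (measurable_itv `[0%R, 1%R]).
    rewrite nuE.
    have <- : rho_ k (box r%:E) = 1%E.
      by rewrite -[box _]setCK probability_setC ?rho_box ?sube0//; exact: measurableC.
    apply: le_measure; rewrite ?inE//.
      rewrite -[X in measurable X]setTI; apply: ms => //.
      exact: (measurable_itv `[0%R, 1%R]).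
    by move=> x /sP[].
  have [Q [Q_homo Q01 QE]] := quantile_exists UE nu01.
  exists Q; split => // A mA.
  have mgA : measurable (gamma @^-1` A) by rewrite -[X in measurable X]setTI; exact: mgamma.
  rewrite comp_preimage -QE// nuE.
  have msgA : measurable (s @^-1` (gamma @^-1` A)).
    by rewrite -[X in measurable X]setTI; exact: ms.
  have restrict B : measurable B -> rho_ k B = rho_ k (B `&` box r%:E).
    move=> mB; rewrite -[in LHS](setIT B) -(setUv (box r%:E)) setIUr measureU0//.
    - exact: measurableI.
    - by apply: measurableI => //; exact: measurableC.
    - apply: subset_measure0 (rho_box k) => //; last exact: measurableC.
      by apply: measurableI => //; exact: measurableC.
  rewrite restrict// [RHS]restrict//; congr (rho_ k _).
  by apply/seteqP; split => x /= [Ax bx]; split => //; have [_ e] := sP x bx;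
    move: Ax; rewrite e.
have [Q hQ] := choice quant.
have Q_homo k : {homo Q k : x y / x <= y} by have [] := hQ k.
have Q01 k t : 0 <= Q k t <= 1 by have [_ + _] := hQ k; exact.
have [iota [G [D [hiota G_homo cD cv]]]] := helly_selection Q_homo Q01.
have mono_meas (f : R -> R) : {homo f : x y / x <= y} ->
    measurable_fun setT (f : measurableTypeR R -> measurableTypeR R).
  by move=> hf; exact: nondecreasing_measurable.
pose X_ k : measurableTypeR R -> 'rV[R]_d := gamma \o Q (iota k).
pose X : measurableTypeR R -> 'rV[R]_d := gamma \o G.
have mX_ k : measurable_fun setT (X_ k).
  by apply: (measurableT_comp mgamma); exact: mono_meas.
have mX : measurable_fun setT X by apply: (measurableT_comp mgamma); exact: mono_meas.
have [rho rhoE] := pushforward_exists U mX.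
exists iota, rho; split => //.
  rewrite rhoE (_ : _ @^-1` _ = set0) ?measure0//.
  by apply/seteqP; split => // t; apply; apply: box_curve_in_box; exact: ltW.
have mk := measurable_difference_kernel mV.
have k0 := difference_kernel_ge0 V_ge0.
rewrite (interaction_pushforward mk k0 mX (fun A _ => rhoE A)).
have JE k : J (rho_ (iota k)) =
    (\int[U]_s \int[U]_t difference_kernel V (X_ k s, X_ k t))%E.
  by apply: interaction_pushforward => // A mA; have [_ _ ->] := hQ (iota k).
have -> : (fun k => J (rho_ (iota k))) = (fun k =>
    \int[U]_s \int[U]_t difference_kernel V (X_ k s, X_ k t))%E by exact/funext.
apply: fatou_double_integral => //.
exists D; split.
- exact: countable_measurable.
- apply: etrans (UE D) _; apply: countable_lebesgue_measure0.
  by apply: sub_countable cD; apply: subset_card_le; exact: subIsetl.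
- move=> t /= h; apply: contrapT => Dt; apply: h.
  by apply: (cvg_comp _ _ (cv t Dt)); exact: cgamma.
Qed.

Lemma box_minimiser_exists (r : R) : 0 < r ->
  exists rho : probability 'rV[R]_d R, rho (~` box r%:E) = 0%E /\
    forall nu : probability 'rV[R]_d R, nu (~` box r%:E) = 0%E -> (J rho <= J nu)%E.
Proof.
move=> r0.
pose energies := [set J nu | nu in [set nu : probability 'rV[R]_d R |
  nu (~` box r%:E) = 0%E]].
have J0 (nu : probability 'rV[R]_d R) : (0 <= J nu)%E.
  exact: (interaction_ge0 (difference_kernel_ge0 V_ge0)).
have inf_le (nu : probability 'rV[R]_d R) : nu (~` box r%:E) = 0%E -> (ereal_inf energies <= J nu)%E.
  by move=> nubox; apply: ereal_inf_lbound; exists nu.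
have [infy|infy] := eqVneq (ereal_inf energies) +oo%E.
  have d0 : (\d_(0 : 'rV[R]_d) : probability 'rV[R]_d R) (~` box r%:E) = 0%E.
    rewrite /= diracE memNset//=; apply; rewrite /box/= normr0 lee_fin; exact: ltW.
  exists (\d_(0 : 'rV[R]_d)); split => // nu nubox.
  by apply: le_trans (inf_le nu nubox); rewrite infy leey.
have inf_fin : ereal_inf energies \is a fin_num.
  rewrite ge0_fin_numE ?ltey//.
  by apply: le_ereal_inf_tmp => _ [nu _ <-].
have min_seq k : exists nu : probability 'rV[R]_d R, nu (~` box r%:E) = 0%E /\
    (J nu <= ereal_inf energies + k.+1%:R^-1%:E)%E.
  have k0 : 0 < k.+1%:R^-1 :> R by rewrite invr_gt0.
  have [_ [nu nubox <-] /ltW h] := lb_ereal_inf_adherent k0 inf_fin.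
  by exists nu.
have [rho_ hrho] := choice min_seq.
have [iota [rho [hiota rho_box hJ]]] := box_compactness r0 (fun k => (hrho k).1).
exists rho; split => // nu nubox; apply: le_trans (inf_le nu nubox).
apply: le_trans hJ _; apply/lee_addgt0Pr => e e0.
apply: limn_einf_le.
have near_e := near_infty_natSinv_lt (PosNum e0).
apply: filterS near_e => k hk; apply: le_trans (hrho (iota k)).2 _.
rewrite leeD2l// lee_fin; apply: le_trans (ltW hk).
by rewrite lef_pV2 ?posrE// ler_nat ltnS; exact: hiota.
Qed.

End box_compactness.

(** * Global minimisers of a nonnegative potential *)

Section minimisers.
Context {R : realType} {d : nat}.
Variable V : 'rV[R]_d -> \bar R.
Hypothesis mV : measurable_fun setT V.
Hypothesis V_ge0 : forall x, (0 <= V x)%E.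
Hypothesis V_even : forall x, V x = V (- x).
Hypothesis V_lsc : lower_semicontinuous V.
Variables (L r r6 : R).
Hypothesis r_gt0 : 0 < r.
Hypothesis L_gt0 : 0 < L.
Hypothesis V_far : forall z, r <= `|z| -> (L%:E <= V z)%E.
Hypothesis r6_gt0 : 0 < r6.
Hypothesis V_incr : forall j, strictly_increasing_along V j r6.
Local Notation k := (difference_kernel V).
Local Notation J rho := (interaction (difference_kernel V) rho rho).
Let mk := measurable_difference_kernel mV.
Let k_ge0 := difference_kernel_ge0 V_ge0.
Let k_sym := difference_kernel_sym V_even.
Implicit Types rho nu : probability 'rV[R]_d R.

Definition box_minimiser (n : \bar R) rho :=
  rho (~` box n) = 0%E /\
  forall nu, nu (~` box n) = 0%E -> (J rho <= J nu)%E.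

(** Points are moved towards [y], so a box containing [y] is preserved. *)
Lemma squeeze_box (j : 'I_d) (n : \bar R) (a b s : R) (x y : 'rV[R]_d) : 0 <= s ->
  a + s <= b -> box n y -> y ord0 j <= a -> box n x -> box n (squeeze j b s x).
Proof.
move=> s0 asb; rewrite /box/=; case: n => [t| |] //; last by move=> *; exact: leey.
rewrite !lee_fin => yt ya xt.
apply: rV_norm_le; first exact: le_trans xt.
move=> i; rewrite mxE; case: ifP => [/andP[/eqP -> bx]|_]; last first.
  exact: le_trans (coord_le_norm x i) xt.
have := le_trans (coord_le_norm x j) xt; have := le_trans (coord_le_norm y j) yt.
by rewrite !ler_norml => /andP[? ?] /andP[? ?]; apply/andP; split; lra.
Qed.

(** A bound independent of the box: gaps of width [2 r6] are excluded by
    squeezing by [r6], which leaves the two pieces [r6] apart. *)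
Lemma box_minimiser_spread (n : \bar R) (J0 : R) (N : nat) rho :
  box_minimiser n rho -> (J rho <= J0%:E)%E -> 1 < N%:R * (1 - J0 / L) ->
  exists Z, [/\ measurable Z, rho Z = 0%E & forall x y j, ~ Z x -> ~ Z y ->
    y ord0 j - x ord0 j <= N%:R * (2 * r6 + 2 * r) + 2 * r].
Proof.
move=> [rho_box rho_min] rhoJ0 N1.
have mbC : measurable (~` box n : set 'rV[R]_d).
  by apply: measurableC; exact: measurable_box.
have m0 : 0 < 1 - J0 / L.
  have : 0 < N%:R * (1 - J0 / L) by apply: lt_trans N1.
  rewrite pmulr_rgt0// ltr0n lt0n; apply/eqP => N0.
  by move: N1; rewrite N0 mul0r ltr10.
have [|Z [mZ Z0 hZ]] := minimiser_concentration mV V_ge0 V_even _ rhoJ0 L_gt0 V_far r_gt0.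
  by move=> nu nu_ll; apply: rho_min; apply: nu_ll.
exists Z; split => // x y j Zx Zy.
apply: (@coord_spread_le _ _ rho Z j _ r (2 * r6) Z0 mZ m0 r_gt0 _ hZ _ N) => //.
  by rewrite mulr_gt0.
move=> a gap0.
have [|/eqP left_pos] := eqVneq (rho (slab j `]-oo, a])) 0%E; first by right.
apply: (@squeeze_gap _ _ V mV V_ge0 V_even rho j a (a + 2 * r6) r6 r6) => //.
- by lra.
- exact: ltW.
- by apply: le_lt_trans rhoJ0 (ltry _).
move=> nu nuE; apply: rho_min; rewrite nuE.
have [y' [y'a y'box]] : exists y' : 'rV[R]_d, y' ord0 j <= a /\ box n y'.
  apply/not_existsP => h; apply: left_pos.
  apply: subset_measure0 rho_box => //; first exact: measurable_slab.
  move=> u; rewrite /slab/= in_itv/= => ua ubox; exact: (h u).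
apply: subset_measure0 rho_box => //.
  by rewrite -[X in measurable X]setTI; apply: measurable_squeeze.
move=> u /= hu ubox; apply: hu.
have r60 : 0 < r6 := r6_gt0.
by apply: (@squeeze_box j n a _ _ u y') => //; lra.
Qed.

(** Restricting a nonnegative energy to a box and renormalising only costs the
    square of the mass. *)
Lemma truncation (n : \bar R) rho (p : R) : rho (box n) = p%:E -> 0 < p ->
  exists nu, nu (~` box n) = 0%E /\ ((p ^+ 2)%:E * J nu <= J rho)%E.
Proof.
move=> rp p0; have mb : measurable (box n : set 'rV[R]_d) by exact: measurable_box.
have mT : mrestr rho mb setT = p%:E by rewrite /mrestr setTI.
have [nu nuE] := normalize_exists rho p0 mT.
exists nu; split.
  have out0 : mrestr rho mb (~` box n) = 0%E by rewrite /mrestr setICl measure0.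
  have /eqP := etrans (esym (nuE (~` box n))) out0.
  by rewrite mule_eq0 eqe gt_eqF//= => /eqP.
rewrite -(interaction_normalize mk k_ge0 p0 nuE).
apply: le_trans (interaction_mrestr_le mk k_ge0 _ _ mb) _.
by rewrite (interactionC mk k_ge0 k_sym); exact: interaction_mrestr_le.
Qed.

Lemma mass_box_cvg rho (e : R) : 0 < e -> exists n : nat, forall m : R, n%:R <= m ->
  exists p, [/\ rho (box m%:E) = p%:E, 1 - e < p & p <= 1].
Proof.
move=> e0; pose B (n : nat) : set 'rV[R]_d := box n%:R%:E.
have BT : \bigcup_n B n = setT.
  apply/seteqP; split => // x _; exists (Num.truncn `|x|).+1 => //.
  by rewrite /B /box/= lee_fin ltW// truncnS_gt.
have cv : rho (B n) @[n --> \oo] --> 1%E.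
  rewrite -(probability_setT rho) -BT; apply: nondecreasing_cvg_mu.
  - by move=> n; exact: measurable_box.
  - by rewrite BT.
  - move=> m n mn; apply/subsetPset => x; rewrite /B /box/= !lee_fin => /le_trans.
    by apply; rewrite ler_nat.
have {}cv : fine (rho (B n)) @[n --> \oo] --> (1 : R) by exact: fine_cvg.
have [n hn] : exists n, `|1 - fine (rho (B n))| < e.
  by move/cvgrPdist_lt : cv => /(_ _ e0)/filter_ex[n ?]; exists n.
exists n => m nm; exists (fine (rho (box m%:E))).
have mb t : measurable (box t : set 'rV[R]_d) by exact: measurable_box.
have fin t : rho (box t) \is a fin_num by exact: fin_num_measure.
split; first by rewrite fineK.
- have : fine (rho (B n)) <= fine (rho (box m%:E)).
    rewrite -lee_fin !fineK; [|exact: fin|exact: fin].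
    apply: le_measure; rewrite ?inE; [exact: mb|exact: mb|].
    by move=> x; rewrite /B /box/= !lee_fin => /le_trans; exact.
  by move: hn; rewrite ltr_norml => /andP[? ?] ?; lra.
- by rewrite -lee_fin fineK//; exact: probability_le1.
Qed.

Lemma box_subset (m n : \bar R) rho : (m <= n)%E ->
  rho (~` box m) = 0%E -> rho (~` box n) = 0%E.
Proof.
move=> mn; apply: subset_measure0.
- by apply: measurableC; exact: measurable_box.
- by apply: measurableC; exact: measurable_box.
- by move=> x /= h xm; apply: h; apply: le_trans xm mn.
Qed.

(** Translate a typical point to the origin. *)
Lemma translate_into_box rho (Z : set 'rV[R]_d) (D : R) : 0 <= D ->
  measurable Z -> rho Z = 0%E ->
  (forall x y j, ~ Z x -> ~ Z y -> y ord0 j - x ord0 j <= D) ->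
  exists nu, nu (~` box D%:E) = 0%E /\ J nu = J rho.
Proof.
move=> D0 mZ Z0 spread.
have [x0 Zx0] : exists x0, ~ Z x0.
  apply/existsNP => h; have := probability_setT rho.
  rewrite (_ : [set: _] = Z) ?Z0; last by apply/seteqP; split => x // _; exact: h.
  by move/eqP; rewrite lt_eqF// lte_fin.
pose X (x : 'rV[R]_d) := x - x0.
have mX : measurable_fun setT X by apply: measurable_rV_sub.
have [nu nuE] := pushforward_exists rho mX.
exists nu; split.
  rewrite nuE; apply: subset_measure0 Z0 => //.
    rewrite -[X in measurable X]setTI; apply: mX => //.
    by apply: measurableC; exact: measurable_box.
  move=> x /= h; apply: contrapT => Zx; apply: h; rewrite /box/= lee_fin.
  apply: rV_norm_le => // j; rewrite !mxE ler_norml.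
  have := spread _ _ j Zx0 Zx; have := spread _ _ j Zx Zx0.
  by move=> ? ?; apply/andP; split; lra.
rewrite (interaction_pushforward mk k_ge0 mX (fun A _ => nuE A)).
apply: eq_integral => s _; apply: eq_integral => t _.
by rewrite /difference_kernel/= /X opprB addrA subrK.
Qed.

Variables (mu0 : probability 'rV[R]_d R).
Hypothesis mu0_lt : (J mu0 < L%:E)%E.

Let J0 := fine (J mu0).
Let J0E : J mu0 = J0%:E.
Proof.
rewrite fineK// ge0_fin_numE ?(lt_trans mu0_lt) ?ltry//.
exact: interaction_ge0.
Qed.
Let J0_ge0 : 0 <= J0.
Proof. by rewrite -lee_fin -J0E; exact: interaction_ge0. Qed.
Let J1 := (J0 + L) / 2.
Let J01 : J0 < J1 < L.
Proof.
have : J0 < L by rewrite -lte_fin -J0E.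
by rewrite /J1 => ?; apply/andP; split; lra.
Qed.

Lemma spread_bound_exists : exists2 D, 0 < D & forall n rho,
  box_minimiser n rho -> (J rho <= J1%:E)%E ->
  exists Z, [/\ measurable Z, rho Z = 0%E & forall x y j, ~ Z x -> ~ Z y ->
    y ord0 j - x ord0 j <= D].
Proof.
have c0 : 0 < 1 - J1 / L.
  by rewrite subr_gt0 ltr_pdivrMr// mul1r; case/andP: J01.
have [N N1] : exists N : nat, 1 < N%:R * (1 - J1 / L).
  exists (Num.truncn (1 - J1 / L)^-1).+1.
  by rewrite -ltr_pdivrMr// mul1r truncnS_gt.
exists (N%:R * (2 * r6 + 2 * r) + 2 * r).
  apply: ltr_wpDl; last by rewrite mulr_gt0.
  by apply: mulr_ge0 => //; apply: addr_ge0; apply: mulr_ge0 => //; exact: ltW.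
by move=> n rho rho_min rhoJ1; exact: (box_minimiser_spread rho_min rhoJ1 N1).
Qed.

(** All large cubes carry a measure of energy at most [J1], which lies strictly
    between the energy of [mu0] and [L]. *)
Lemma truncated_competitor : exists n : nat, forall m : R, n%:R <= m ->
  exists nu, nu (~` box m%:E) = 0%E /\ (J nu <= J1%:E)%E.
Proof.
have /andP[J01' J1L] := J01; have J1_gt0 : 0 < J1 by exact: le_lt_trans J01'.
(* chosen so that [(1 - 2 e) J1 = J0], whence [J0 <= p ^ 2 J1] *)
pose e := (J1 - J0) / (2 * J1).
have e0 : 0 < e by rewrite divr_gt0 ?subr_gt0// mulr_gt0.
have eJ : e * (2 * J1) = J1 - J0 by rewrite divfK// gt_eqF// mulr_gt0.
have e1 : e <= 1 / 2.
  by rewrite ler_pdivrMr ?mulr_gt0//; have := J0_ge0; lra.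
have [n hn] := mass_box_cvg mu0 e0; exists n => m /hn[p [pE p1 _]].
have p0 : 0 < p by lra.
have [nu [nu_box nuJ]] := truncation pE p0; exists nu; split => //.
have pp : J0 <= p ^+ 2 * J1.
  have p2 : 1 - 2 * e <= p ^+ 2 by nra.
  by apply: le_trans (ler_wpM2r (ltW J1_gt0) p2); lra.
have p20 : 0 < p ^+ 2 by rewrite exprn_gt0.
rewrite -(@lee_pmul2l _ (p ^+ 2)%:E) ?lte_fin// -EFinM.
by apply: le_trans nuJ _; rewrite J0E lee_fin.
Qed.

Lemma minimiser_exists : exists rho, forall nu, (J rho <= J nu)%E.
Proof.
have [D D0 spread] := spread_bound_exists.
have [n0 competitor] := truncated_competitor.
pose M := Num.max n0%:R D.
have M0 : 0 < M by rewrite lt_max D0 orbT.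
have [rho [rho_box rho_min]] := box_minimiser_exists mV V_ge0 V_lsc M0.
exists rho.
have compact_case nu (m : R) : M <= m -> nu (~` box m%:E) = 0%E -> (J rho <= J nu)%E.
  move=> Mm nu_box; have m0 : 0 < m by exact: lt_le_trans Mm.
  have [rm [rm_box rm_min]] := box_minimiser_exists mV V_ge0 V_lsc m0.
  have [|nu1 [nu1_box nu1J]] := competitor m.
    by apply: le_trans Mm; rewrite le_max lexx.
  have rmJ : (J rm <= J1%:E)%E by apply: le_trans nu1J; exact: rm_min.
  have [Z [mZ Z0 hZ]] := spread _ _ (conj rm_box rm_min) rmJ.
  have [rt [rt_box rtJ]] := translate_into_box (ltW D0) mZ Z0 hZ.
  apply: le_trans (rm_min _ nu_box); rewrite -rtJ; apply: rho_min.
  by apply: box_subset rt_box; rewrite lee_fin le_max lexx orbT.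
have rhoJ1 : (J rho <= J1%:E)%E.
  have [|nu1 [nu1_box nu1J]] := competitor M; first by rewrite le_max lexx.
  by apply: le_trans nu1J; exact: rho_min.
have rho_fin : J rho \is a fin_num.
  rewrite ge0_fin_numE ?(le_lt_trans rhoJ1) ?ltry//; exact: interaction_ge0.
move=> nu.
have nu0 : (0 <= J nu)%E by exact: interaction_ge0.
have [nufin|] := boolP (J nu \is a fin_num); last first.
  by rewrite ge0_fin_numE// -leNgt leye_eq => /eqP ->; exact: leey.
have j0 : 0 <= fine (J rho) by apply: fine_ge0; exact: interaction_ge0.
rewrite -(fineK rho_fin) -(fineK nufin) lee_fin.
apply/ler_addgt0Pr => e e0.
(* a loss of mass [e'] costs at most [2 e' J rho <= e] in energy *)
pose e' := Num.min (1 / 2) (e / (2 * (fine (J rho) + 1))).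
have jp : 0 < 2 * (fine (J rho) + 1) by rewrite mulr_gt0// ltr_wpDl.
have e'0 : 0 < e' by rewrite lt_min !divr_gt0.
have e'1 : e' <= 1 / 2 by rewrite ge_min lexx.
have e'2 : e' * (2 * (fine (J rho) + 1)) <= e.
  by rewrite -ler_pdivlMr// ge_min lexx orbT.
clearbody e'.
have [n hn] := mass_box_cvg nu e'0.
have [|p [pE p1 pl1]] := hn (Num.max n%:R M); first by rewrite le_max lexx.
have p0 : 0 < p by lra.
have [nt [nt_box ntJ]] := truncation pE p0.
have ntM : (J rho <= J nt)%E by apply: compact_case nt_box; rewrite le_max lexx orbT.
have : ((p ^+ 2)%:E * J rho <= J nu)%E.
  by apply: le_trans ntJ; rewrite lee_wpmul2l// lee_fin sqr_ge0.
rewrite -(fineK rho_fin) -(fineK nufin) -EFinM lee_fin.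
move: (fine _) (fine _) j0 e'2 {jp} => q j j0 e'2 pjq.
have p2 : 1 - 2 * e' <= p ^+ 2 by nra.
by have := ler_wpM2r j0 p2; rewrite /=; lra.
Qed.

Lemma minimiser_spread : exists2 D : R, 0 < D & forall rho,
  (forall nu, (J rho <= J nu)%E) ->
  exists Z, [/\ measurable Z, rho Z = 0%E & forall x y j, ~ Z x -> ~ Z y ->
    y ord0 j - x ord0 j <= D].
Proof.
have [D D0 spread] := spread_bound_exists; exists D => // rho rho_min.
apply: (spread +oo%E).
  split => [|nu _]; last exact: rho_min.
  rewrite (_ : ~` _ = set0) ?measure0//; apply/seteqP; split => // x; apply.
  exact: leey.
apply: le_trans (rho_min mu0) _; rewrite J0E lee_fin ltW//.
by case/andP: J01.
Qed.

End minimisers.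

(** * From typical points to the support, and the theorem *)

Section euclidean_norm.
Context {R : realType} {d : nat}.
Implicit Types x : 'rV[R]_d.

Lemma norm_le_enorm x : `|x| <= enorm x.
Proof.
apply: rV_norm_le => [|j]; first exact: sqrtr_ge0.
rewrite -sqrtr_sqr ler_wsqrtr// (bigD1 j)//= lerDl.
by apply: sumr_ge0 => i _; exact: sqr_ge0.
Qed.

Lemma enorm_le x (c : R) : 0 <= c -> (forall j, `|x ord0 j| <= c) ->
  enorm x <= Num.sqrt d%:R * c.
Proof.
move=> c0 h; rewrite -[c]ger0_norm// -sqrtr_sqr -sqrtrM// ler_wsqrtr//.
rewrite mulr_natl -[d in leRHS]card_ord -sumr_const ler_sum// => j _.
by rewrite -real_normK ?num_real// lerXn2r// nnegrE.
Qed.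

End euclidean_norm.

Section support.
Context {R : realType} {d : nat}.
Variables (rho : probability 'rV[R]_d R) (Z : set 'rV[R]_d) (D : R).
Hypothesis D_ge0 : 0 <= D.
Hypothesis mZ : measurable Z.
Hypothesis Z0 : rho Z = 0%E.
Hypothesis spread : forall x y j, ~ Z x -> ~ Z y -> y ord0 j - x ord0 j <= D.

(** A null set cannot fill a neighbourhood of a point of the support, so bounds
    that hold at typical points extend to the support. *)
Lemma support_typical (x : 'rV[R]_d) (e : R) : 0 < e -> msupport rho x ->
  exists2 y, ball x e y & ~ Z y.
Proof.
move=> e0 sx; apply: contrapT => h.
have oB : open (ball x e) by exact: ball_open.
have := sx _ oB (ballxx x e0); rewrite (_ : rho _ = 0%E) ?ltxx//.
apply: subset_measure0 Z0 => //; first exact: open_measurable_rV.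
by move=> y xy; apply: contrapT => Zy; apply: h; exists y.
Qed.

Lemma support_coord_le (x y : 'rV[R]_d) j : msupport rho x -> msupport rho y ->
  y ord0 j - x ord0 j <= D.
Proof.
move=> sx sy; apply/ler_addgt0Pr => e e0.
have e2 : 0 < e / 2 by rewrite divr_gt0.
have [x' /(ball_coord j)/andP[? ?] Zx'] := support_typical e2 sx.
have [y' /(ball_coord j)/andP[? ?] Zy'] := support_typical e2 sy.
by have := spread j Zx' Zy'; lra.
Qed.

Lemma closed_msupport : closed (msupport rho).
Proof.
rewrite -openC openE => x /= /existsNP[U /not_implyP[oU /not_implyP[Ux Unull]]].
have : nbhs x U by exact: open_nbhs_nbhs.
by rewrite /interior; apply: filterS => y Uy sy; apply: Unull; exact: sy.
Qed.

Lemma compact_msupport : compact (msupport rho).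
Proof.
have [[x sx]|nsupp] := pselect (msupport rho !=set0); last first.
  rewrite (_ : msupport rho = set0); first exact: compact0.
  by apply/seteqP; split => // x sx; apply: nsupp; exists x.
apply: bounded_closed_compact closed_msupport.
exists (`|x| + D); split; first exact: num_real.
move=> M xDM y sy /=; apply: le_trans (ltW xDM).
rewrite -lerBlDl; apply: le_trans (lerB_dist _ _) _.
apply: rV_norm_le => // j; rewrite !mxE ler_norml.
have := support_coord_le j sx sy; have := support_coord_le j sy sx.
by move=> ? ?; apply/andP; split; lra.
Qed.

Lemma diam_msupport_le : (diam (msupport rho) <= (Num.sqrt d%:R * D)%:E)%E.
Proof.
apply: ge_ereal_sup => _ [x sx [y sy <-]]; rewrite lee_fin.
apply: enorm_le => // j; rewrite !mxE ler_norml.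
have := support_coord_le j sx sy; have := support_coord_le j sy sx.
by move=> ? ?; apply/andP; split; lra.
Qed.

End support.

(** Although [f] may fail to be integrable, its negative part is bounded, so the
    difference defining its integral can be rearranged. *)
Lemma integral_shift dd (T : measurableType dd) (R : realType) (P : {measure set T -> \bar R})
    (f : T -> \bar R) (c : R) : P setT = 1%E -> measurable_fun setT f -> c <= 0 ->
  (forall x, (c%:E <= f x)%E) ->
  (\int[P]_x f x = \int[P]_x (f x - c%:E) + c%:E)%E.
Proof.
move=> P1 mf c0 cf.
have fn_le x : (f^\- x <= (- c)%:E)%E.
  rewrite funenegE ge_max; apply/andP; split; last by rewrite lee_fin oppr_ge0.
  by rewrite EFinN leeN2 cf.
have h0 x : (0 <= f x - c%:E)%E by rewrite sube_ge0.
have mfp := measurable_funepos mf; have mfn := measurable_funeneg mf.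
have mh : measurable_fun setT (fun x => f x - c%:E)%E by exact: emeasurable_funB.
have cst_int : (\int[P]_x (- c)%:E = (- c)%:E)%E.
  by rewrite integral_cst// P1 mule1.
have eqn : (\int[P]_x f^\+ x + (- c)%:E = \int[P]_x (f x - c%:E) + \int[P]_x f^\- x)%E.
  rewrite -cst_int -!ge0_integralD//; last by move=> x _; rewrite lee_fin oppr_ge0.
  apply: eq_integral => x _; rewrite funeposE funenegE.
  have := cf x; case: (f x) => [t| |]//= _.
  rewrite -?EFinN -!EFin_max -!EFinD; congr EFin.
    by case: (leP 0 t) => t0; case: (leP 0 (- t)) => t1; lra.
  by rewrite maxye maxNye.
have fn_fin : (\int[P]_x f^\- x)%E \is a fin_num.
  rewrite ge0_fin_numE ?integral_ge0//; apply: le_lt_trans (ltry (- c)).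
  by rewrite -cst_int; apply: ge0_le_integral => // x _; rewrite lee_fin oppr_ge0.
rewrite [LHS]integralE.
move: (\int[P]_x f^\+ x)%E (\int[P]_x f^\- x)%E (\int[P]_x (f x - c%:E))%E fn_fin eqn.
move=> [a| |] [n| |]// [b| |]// _ /= [] h; congr EFin; lra.
Qed.

Section energy_shift.
Context {R : realType} {d : nat}.
Variables (W : 'rV[R]_d -> \bar R) (c : R).
Hypothesis mW : measurable_fun setT W.
Hypothesis c0 : c <= 0.
Hypothesis cW : forall x, (c%:E <= W x)%E.

Definition shifted (x : 'rV[R]_d) : \bar R := (W x - c%:E)%E.

Lemma measurable_shifted : measurable_fun setT shifted.
Proof. exact: emeasurable_funB. Qed.

Lemma shifted_ge0 x : (0 <= shifted x)%E.
Proof. by rewrite sube_ge0. Qed.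

Lemma energy_shifted (rho : probability 'rV[R]_d R) :
  energy W rho =
  (2^-1%:E * (interaction (difference_kernel shifted) rho rho + c%:E))%E.
Proof.
rewrite (interactionE (measurable_difference_kernel measurable_shifted)
  (difference_kernel_ge0 shifted_ge0)).
rewrite /energy.
congr (_ * _)%E; apply: integral_shift => //.
- have := product_measure1E rho rho measurableT measurableT.
  rewrite setXTT => e; apply: etrans e _.
  by rewrite -[RHS]mule1; congr (_ * _)%E; exact: probability_setT.
- exact: measurableT_comp measurable_rV_diff.
Qed.

End energy_shift.

Theorem theorem1p4 (R : realType) (d : nat) (hd : (1 <= d)%N)
  (W : 'rV[R]_d -> \bar R)
  (W_range : forall x, W x != -oo%E)
  (W_measurable : measurable_fun [set: 'rV[R]_d] W)
  (W_bounded_below : exists Wmin : R,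
     Wmin < 0 /\ forall x, (Wmin%:E <= W x)%E)
  (W_loc_integrable : loc_integrable W)
  (W_symmetric : forall x, W x = W (- x))
  (W_unstable : exists Winf : \bar R,
     W @ at_infinity --> Winf /\
     exists mu : probability 'rV[R]_d R, (energy W mu < 2^-1%:E * Winf)%E)
  (W_lsc : lower_semicontinuous W)
  (W_increasing : exists R6 : R, 0 < R6 /\
     forall k : 'I_d, strictly_increasing_along W k R6) :
  (exists rho : probability 'rV[R]_d R, global_minimiser W rho) /\
  (exists K : R, 0 < K /\
     forall rho : probability 'rV[R]_d R, global_minimiser W rho ->
       compact (msupport rho) /\ (diam (msupport rho) <= K%:E)%E).
Proof.
have [c [/ltW c0 cW]] := W_bounded_below.
have [Winf [W_cvg [mu mu_lt]]] := W_unstable.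
have [r6 [r6_gt0 W_incr]] := W_increasing.
pose V := shifted W c.
have mV : measurable_fun setT V by exact: measurable_shifted.
have V_ge0 : forall x, (0 <= V x)%E by exact: shifted_ge0.
have V_even x : V x = V (- x) by rewrite /V /shifted W_symmetric.
have VE x a : (a%:E < V x)%E = ((a + c)%:E < W x)%E.
  by rewrite /V /shifted lteBrDr// -EFinD.
have V_lsc : lower_semicontinuous V.
  move=> x a; rewrite VE => /W_lsc[A Ax hA]; exists A => // y /hA.
  by rewrite VE.
have V_incr j : strictly_increasing_along V j r6.
  by move=> x y xy rx xjy; rewrite /V /shifted lteD2rE//; exact: (W_incr j).
pose J (rho : probability 'rV[R]_d R) := interaction (difference_kernel V) rho rho.
have J_ge0 rho : (0 <= J rho)%E by exact: (interaction_ge0 (difference_kernel_ge0 V_ge0)).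
have half0 : (0 : R) < 2^-1 by rewrite invr_gt0.
have energyE rho : energy W rho = (2^-1%:E * (J rho + c%:E))%E by exact: energy_shifted.
have minE rho : global_minimiser W rho <-> forall nu, (J rho <= J nu)%E.
  split=> h nu; have := h nu; rewrite ?/global_minimiser !energyE lee_pmul2l// ?lte_fin//;
    by rewrite leeD2rE.
have [L [L1 L2]] : exists L : R, (J mu < L%:E)%E /\ ((L + c)%:E < Winf)%E.
  have : (J mu + c%:E < Winf)%E.
    by rewrite -(@lte_pmul2l _ 2^-1%:E) ?lte_fin// -energyE.
  case: (J mu) (J_ge0 mu) Winf {W_cvg mu_lt} => [j| |]// _ [w| |]//.
  - rewrite -EFinD lte_fin => jw; exists ((j + (w - c)) / 2).
    by rewrite !lte_fin; split; lra.
  - by move=> _; exists (j + 1); rewrite lte_fin ltrDl ltry.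
have L_gt0 : 0 < L by rewrite -lte_fin; exact: le_lt_trans (J_ge0 mu) L1.
have [r r_gt0 V_far] : exists2 r : R, 0 < r & forall z, r <= `|z| -> (L%:E <= V z)%E.
  have : at_infinity [set x | ((L + c)%:E < W x)%E].
    have Winf_nbhs : nbhs Winf [set y | ((L + c)%:E < y)%E].
      by apply: open_nbhs_nbhs; split => //; exact: open_ereal_gt_ereal.
    exact: (W_cvg _ Winf_nbhs).
  move=> [r [_ hr]]; exists (Num.max 1 (r + 2)); first by rewrite lt_max ltr01.
  move=> z; rewrite ge_max => /andP[_ rz]; apply/ltW; rewrite VE.
  apply: (hr (r + 1)); first by rewrite ltrDl.
  by apply: lt_le_trans (norm_le_enorm z); apply: lt_le_trans rz; rewrite ltrD2l ltr1n.
split.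
  have [rho rho_min] := minimiser_exists mV V_ge0 V_even V_lsc r_gt0 L_gt0 V_far
    r6_gt0 V_incr L1.
  by exists rho; apply/minE.
have [D D0 spread] := minimiser_spread mV V_ge0 V_even r_gt0 L_gt0 V_far
    r6_gt0 V_incr L1.
exists (Num.sqrt d%:R * D); split.
  by rewrite mulr_gt0// sqrtr_gt0 ltr0n.
move=> rho /minE/spread[Z [mZ Z0 hZ]].
by split; [apply: compact_msupport hZ|apply: diam_msupport_le hZ] => //; exact: ltW.
Qed.
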